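(* Let $R$ be a regular local Noetherian ring with maximal ideal $\mathfrak{m}$, complete with respect to $\mathfrak{m}$. The following properties of an $L$-complete $R$-module $M$ are equivalent: \begin{enumerate} \item $M$ is projective in $\widehat{\mathrm{Mod}}_R$. \item $M$ is pro-free, i.e., it is of the form $L_0F$ for some free $F\in\mathrm{Mod}_R$. \item $M$ is flat as an object in $\mathrm{Mod}_R$. \end{enumerate} Furthermore, if $N$ is a flat $R$-module, then $L_0N$ is pro-free and hence flat as an $R$-module.
   Context: $L_0\colon\mathrm{Mod}_R\to\mathrm{Mod}_R$ is the $0$-th left derived functor of $\mathfrak{m}$-adic completion $M\mapsto\varprojlim_kM/\mathfrak{m}^kM$, with natural map $\eta\colon M\to L_0M$; $M$ is $L$-complete if $\eta_M$ is an isomorphism. $\widehat{\mathrm{Mod}}_R\subset\mathrm{Mod}_R$ is the full (abelian) subcategory of $L$-complete modules. *)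

(* Defs.v *)
From HB Require Import structures.
From mathcomp Require Import all_boot all_algebra.
From mathcomp Require Import boolp classical_sets.
From mathcomp Require Import freeg.

Set Implicit Arguments.
Unset Strict Implicit.
Unset Printing Implicit Defensive.

Import GRing.Theory.

Local Open Scope ring_scope.
Local Open Scope quotient_scope.

Section Submodules.
Variables (R : comNzRingType) (V : lmodType R).

(* The smallest submodule containing X. *)
Definition mspan (X : set V) : {pred V} :=
  fun x => `[< forall S : submodClosed V, (forall y, X y -> y \in S) -> x \in S >].

Lemma mspanP (X : set V) x :
  reflect (forall S : submodClosed V, (forall y, X y -> y \in S) -> x \in S)
          (x \in mspan X).
Proof. exact: asboolP. Qed.

Lemma mem_mspan (X : set V) x : X x -> x \in mspan X.
Proof. by move=> Xx; apply/mspanP => S; apply. Qed.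

Lemma mspan_closed (X : set V) : subsemimod_closed (mspan X).
Proof.
split; first split.
- by apply/mspanP => S _; exact: rpred0.
- move=> x y /mspanP hx /mspanP hy; apply/mspanP => S XS.
  by rewrite rpredD ?hx ?hy.
- by move=> a x /mspanP hx; apply/mspanP => S XS; rewrite rpredZ ?hx.
Qed.

HB.instance Definition _ (X : set V) :=
  GRing.isSubmodClosed.Build R V (mspan X) (mspan_closed X).

(* The submodule IX generated by the products a *: v. *)
Definition ideal_smul (I : {pred R}) (X : {pred V}) : {pred V} :=
  mspan [set y | exists a v, [/\ a \in I, v \in X & y = a *: v]].

HB.instance Definition _ (I : {pred R}) (X : {pred V}) :=
  GRing.SubmodClosed.copy (ideal_smul I X)
    (mspan [set y | exists a v, [/\ a \in I, v \in X & y = a *: v]]).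

End Submodules.

Section LinearMaps.
Variables (R : comNzRingType) (U V : lmodType R) (f : {linear U -> V}).

Definition mker : {pred U} := fun x => f x == 0.

Definition mim : {pred V} := fun y => `[< exists x, f x = y >].

Lemma mim_closed : subsemimod_closed mim.
Proof.
split; first split.
- by apply/asboolP; exists 0; rewrite linear0.
- move=> x y /asboolP[u <-] /asboolP[v <-].
  by apply/asboolP; exists (u + v); rewrite linearD.
- by move=> a x /asboolP[u <-]; apply/asboolP; exists (a *: u); rewrite linearZ.
Qed.

HB.instance Definition _ := GRing.isSubmodClosed.Build R V mim mim_closed.

Section Preimage.
Variable T : submodClosed V.

Definition mpreim : {pred U} := fun x => f x \in T.

Lemma mem_mpreim x : (x \in mpreim) = (f x \in T).
Proof. by []. Qed.

Lemma mpreim_closed : subsemimod_closed mpreim.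
Proof.
split; first split.
- by rewrite mem_mpreim linear0 rpred0.
- by move=> x y; rewrite !mem_mpreim linearD; exact: rpredD.
- by move=> a x; rewrite !mem_mpreim linearZ; exact: rpredZ.
Qed.

HB.instance Definition _ := GRing.isSubmodClosed.Build R U mpreim mpreim_closed.

End Preimage.

End LinearMaps.

Section QuotientModule.
Variables (R : comNzRingType) (V : lmodType R) (S : submodClosed V).

(* submodClosed does not inherit from zmodClosed, which Quotient.quot needs. *)
Definition submod_pred : {pred V} := fun x => x \in S.

Lemma submod_predB : zmod_closed submod_pred.
Proof. exact: GRing.submod_closedB (submodClosedP S). Qed.

HB.instance Definition _ := GRing.isZmodClosed.Build V submod_pred submod_predB.

Definition quotmod : Type := Quotient.quot submod_pred.

HB.instance Definition _ := GRing.Zmodule.on quotmod.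

Definition mpi (x : V) : quotmod := \pi_(Quotient.quot submod_pred) x.
Definition mrepr (q : quotmod) : V := repr (q : Quotient.quot submod_pred).

Lemma mreprK : cancel mrepr mpi.
Proof. exact: reprK. Qed.

Lemma mpiP x y : mpi x = mpi y <-> x - y \in S.
Proof. by rewrite (Quotient.idealrBE submod_pred); split=> /eqP. Qed.

Lemma mpiB : zmod_morphism mpi.
Proof. by move=> x y; rewrite /mpi (raddfB \pi_(Quotient.quot submod_pred)). Qed.

HB.instance Definition _ := GRing.isZmodMorphism.Build V quotmod mpi mpiB.

Definition quotmod_scale (a : R) (q : quotmod) : quotmod := mpi (a *: mrepr q).

Lemma mpi_scale a x : quotmod_scale a (mpi x) = mpi (a *: x).
Proof.
by apply/mpiP; rewrite -scalerBr rpredZ //; apply/mpiP; rewrite mreprK.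
Qed.

Lemma quotmod_scaleA a b q :
  quotmod_scale a (quotmod_scale b q) = quotmod_scale (a * b) q.
Proof. by rewrite -[q]mreprK !mpi_scale scalerA. Qed.

Lemma quotmod_scale1 : left_id 1 quotmod_scale.
Proof. by move=> q; rewrite -[q]mreprK mpi_scale scale1r. Qed.

Lemma quotmod_scaleDr : right_distributive quotmod_scale +%R.
Proof.
move=> a p q; rewrite -[p]mreprK -[q]mreprK -raddfD !mpi_scale.
by rewrite scalerDr raddfD.
Qed.

Lemma quotmod_scaleDl q : {morph quotmod_scale^~ q : a b / a + b}.
Proof. by move=> a b; rewrite -[q]mreprK !mpi_scale scalerDl raddfD. Qed.

HB.instance Definition _ := GRing.Zmodule_isLmodule.Build R quotmod
  quotmod_scaleA quotmod_scale1 quotmod_scaleDr quotmod_scaleDl.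

Lemma mpiZ : scalable mpi.
Proof. by move=> a x; rewrite -mpi_scale. Qed.

HB.instance Definition _ := GRing.isScalable.Build R V quotmod *:%R mpi mpiZ.

End QuotientModule.

Section QuotientMap.
Variables (R : comNzRingType) (U V : lmodType R).
Variables (S : submodClosed U) (T : submodClosed V) (f : {linear U -> V}).

(* Only meaningful when f maps S into T: see quotmapE. *)
Definition quotmap (q : quotmod S) : quotmod T := mpi T (f (mrepr q)).

Lemma quotmapE x :
  {in S, forall y, f y \in T} -> quotmap (mpi S x) = mpi T (f x).
Proof.
by move=> fST; apply/mpiP; rewrite -linearB fST //; apply/mpiP; rewrite mreprK.
Qed.

Lemma quotmap_linear : {in S, forall y, f y \in T} -> linear quotmap.
Proof.
move=> fST a p q; rewrite -[p]mreprK -[q]mreprK -linearP !quotmapE //.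
by rewrite !linearP.
Qed.

End QuotientMap.

Section FreeModules.
Variable R : comNzRingType.

Lemma fglift_linear (K : choiceType) (M : lmodType R) (f : K -> M) :
  linear (fglift f : {freeg K / R} -> M).
Proof.
have fgD (x y : {freeg K / R}) : fglift f (x + y) = fglift f x + fglift f y.
  have fgB := lift_is_additive f.
  have fg0 : fglift f 0 = 0 by rewrite -[0 in LHS](subrr 0) fgB subrr.
  have fgN z : fglift f (- z) = - fglift f z by rewrite -sub0r fgB fg0 sub0r.
  by rewrite -[y in LHS]opprK fgB fgN opprK.
have fg0 : fglift f 0 = 0 by apply: (addrI (fglift f 0)); rewrite -fgD !addr0.
have fgS (I : Type) (s : seq I) (F : I -> {freeg K / R}) :
    fglift f (\sum_(i <- s) F i) = \sum_(i <- s) fglift f (F i).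
  by elim: s => [|i s IH]; rewrite ?big_nil // !big_cons fgD IH.
move=> a x y; rewrite fgD; congr (_ + _).
rewrite -[x in RHS]freeg_sumE fgS scaler_sumr.
have -> : a *: x = fgscale a x by [].
rewrite /fgscale fgS; apply: eq_bigr => k _.
by rewrite !liftU scalerA.
Qed.

HB.instance Definition _ (K : choiceType) (M : lmodType R) (f : K -> M) :=
  GRing.isLinear.Build R {freeg K / R} M *:%R (fglift f) (fglift_linear f).

Definition fggen (K : choiceType) (k : K) : {freeg K / R} := << k >>.

Definition lmod_iso (M N : lmodType R) : Prop :=
  exists f : {linear M -> N}, bijective f.

Definition free_module (F : lmodType R) : Prop :=
  exists K : choiceType, lmod_iso F {freeg K / R}.

End FreeModules.

Section Tensor.
Variables (R : comNzRingType) (A M : lmodType R).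

Definition bilin_rel : set {freeg (A * M)%type / R} := [set z |
  [\/ exists a a' x, z = fggen R (a + a', x) - fggen R (a, x) - fggen R (a', x),
      exists a x x', z = fggen R (a, x + x') - fggen R (a, x) - fggen R (a, x'),
      exists r a x, z = fggen R (r *: a, x) - r *: fggen R (a, x)
    | exists r a x, z = fggen R (a, r *: x) - r *: fggen R (a, x)]].

(* A (x) M: the free module on the pairs (a, x), i.e. on A * M, modulo the
   bilinearity relations. *)
Definition tensor : lmodType R := quotmod (mspan bilin_rel).

Definition tens (a : A) (x : M) : tensor :=
  mpi (mspan bilin_rel) (fggen R (a, x)).

End Tensor.

Arguments bilin_rel {R} A M.

Section Flatness.
Variable R : comNzRingType.

(* f (x) id_M; see tensor_mapE for its value on elementary tensors. *)
Definition tensor_map (A B M : lmodType R) (f : {linear A -> B}) :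
    tensor A M -> tensor B M :=
  quotmap (mspan (bilin_rel B M)) (fglift (fun p => fggen R (f p.1, p.2))).

Lemma tensor_mapE (A B M : lmodType R) (f : {linear A -> B}) a (x : M) :
  tensor_map f (tens a x) = tens (f a) x.
Proof.
pose g : {linear {freeg (A * M)%type / R} -> {freeg (B * M)%type / R}} :=
  fglift (fun p => fggen R (f p.1, p.2)).
have gE b y : g (fggen R (b, y)) = fggen R (f b, y).
  by rewrite /g /= /fggen liftU scale1r.
rewrite /tensor_map /tens quotmapE => [|z]; first exact: congr1 (gE a x).
move=> /mspanP zS; suff : g z \in mspan (bilin_rel B M) by [].
apply: (zS (mpreim g (mspan (bilin_rel B M)))) => {zS}z Hz.
rewrite mem_mpreim; apply: mem_mspan.
case: Hz => -[r [b [y ->]]].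
- by rewrite !linearB !gE linearD; constructor 1; do 3!eexists.
- by rewrite !linearB !gE; constructor 2; do 3!eexists.
- by rewrite linearB linearZ !gE linearZ; constructor 3; do 3!eexists.
- by rewrite linearB linearZ !gE; constructor 4; do 3!eexists.
Qed.

Definition flat (M : lmodType R) : Prop :=
  forall (A B : lmodType R) (f : {linear A -> B}),
    injective f -> injective (@tensor_map A B M f).

End Flatness.

Section Product.
Variables (R : comNzRingType) (V : nat -> lmodType R).

Definition mprod : Type := forall k, V k.

HB.instance Definition _ := Choice.copy mprod (forall k, V k).

Implicit Types x y z : mprod.

Definition mprod_add x y : mprod := fun k => x k + y k.
Definition mprod_opp x : mprod := fun k => - x k.
Definition mprod_scale a x : mprod := fun k => a *: x k.

Fact mprod_addA : associative mprod_add.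
Proof. by move=> x y z; apply: functional_extensionality_dep => k; exact: addrA. Qed.
Fact mprod_addC : commutative mprod_add.
Proof. by move=> x y; apply: functional_extensionality_dep => k; exact: addrC. Qed.
Fact mprod_add0 : left_id ((fun=> 0) : mprod) mprod_add.
Proof. by move=> x; apply: functional_extensionality_dep => k; exact: add0r. Qed.
Fact mprod_addN : left_inverse ((fun=> 0) : mprod) mprod_opp mprod_add.
Proof. by move=> x; apply: functional_extensionality_dep => k; exact: addNr. Qed.

HB.instance Definition _ :=
  GRing.isZmodule.Build mprod mprod_addA mprod_addC mprod_add0 mprod_addN.

Fact mprod_scaleA a b x : mprod_scale a (mprod_scale b x) = mprod_scale (a * b) x.
Proof. by apply: functional_extensionality_dep => k; exact: scalerA. Qed.
Fact mprod_scale1 : left_id 1 mprod_scale.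
Proof. by move=> x; apply: functional_extensionality_dep => k; exact: scale1r. Qed.
Fact mprod_scaleDr : right_distributive mprod_scale +%R.
Proof. by move=> a x y; apply: functional_extensionality_dep => k; exact: scalerDr. Qed.
Fact mprod_scaleDl x : {morph mprod_scale^~ x : a b / a + b}.
Proof. by move=> a b; apply: functional_extensionality_dep => k; exact: scalerDl. Qed.

HB.instance Definition _ := GRing.Zmodule_isLmodule.Build R mprod
  mprod_scaleA mprod_scale1 mprod_scaleDr mprod_scaleDl.

End Product.

Section Completion.
Variables (R : comNzRingType) (m : {pred R}).

Fixpoint ideal_pow (k : nat) : {pred R} :=
  if k is k'.+1 then ideal_smul (V := R^o) m (ideal_pow k') else predT.

Lemma ideal_powS k : {subset ideal_pow k.+1 <= ideal_pow k}.
Proof.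
elim: k => [//|k IH] x /mspanP xS.
apply: (xS (ideal_smul (V := R^o) m (ideal_pow k))) => y [a [v [am vk ->]]].
by apply: mem_mspan; exists a, v; split => //; exact: IH.
Qed.

Section Objects.
Variable V : lmodType R.

Definition adic_sub (k : nat) : submodClosed V := ideal_smul (ideal_pow k) predT.

Lemma adic_subS k : {subset adic_sub k.+1 <= adic_sub k}.
Proof.
move=> x /mspanP xS; apply: (xS (adic_sub k)) => y [a [v [ak _ ->]]].
by apply: mem_mspan; exists a, v; split => //; exact: ideal_powS.
Qed.

(* The projection V/m^(k+1)V -> V/m^kV. *)
Definition adic_transition k :
    quotmod (adic_sub k.+1) -> quotmod (adic_sub k) :=
  quotmap (adic_sub k) (idfun : {linear V -> V}).

Lemma adic_transitionE k x :
  @adic_transition k (mpi _ x) = mpi _ x.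
Proof. by apply: quotmapE => y; exact: adic_subS. Qed.

Lemma adic_transition_linear k : linear (@adic_transition k).
Proof. by apply: quotmap_linear => y; exact: adic_subS. Qed.

HB.instance Definition _ k :=
  GRing.isLinear.Build R (quotmod (adic_sub k.+1)) (quotmod (adic_sub k)) *:%R
    (@adic_transition k) (@adic_transition_linear k).

Definition adic_compatible :
    {pred mprod (fun k => quotmod (adic_sub k) : lmodType R)} :=
  fun x => `[< forall k, adic_transition (x k.+1) = x k >].

Lemma adic_compatible_closed : subsemimod_closed adic_compatible.
Proof.
split; first split.
- by apply/asboolP => k; exact: linear0.
- move=> x y /asboolP hx /asboolP hy; apply/asboolP => k.
  exact: etrans (linearD (@adic_transition k) _ _) (congr2 +%R (hx k) (hy k)).
- move=> a x /asboolP hx; apply/asboolP => k.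
  exact: etrans (linearZZ (@adic_transition k) _ _) (congr1 ( *:%R a) (hx k)).
Qed.

HB.instance Definition _ := GRing.isSubmodClosed.Build R
  (mprod (fun k => quotmod (adic_sub k) : lmodType R))
  adic_compatible adic_compatible_closed.

(* lim_k V/m^kV as the submodule of compatible sequences in the product. *)
Record completion : Type := Completion {
  completion_seq : mprod (fun k => quotmod (adic_sub k) : lmodType R);
  completionP : completion_seq \in adic_compatible }.

HB.instance Definition _ := [isSub for completion_seq].
HB.instance Definition _ := [Choice of completion by <:].
HB.instance Definition _ := [SubChoice_isSubLmodule of completion by <:].

Lemma const_compatible (x : V) :
  ((fun k => mpi (adic_sub k) x) :
     mprod (fun k => quotmod (adic_sub k) : lmodType R)) \in adic_compatible.
Proof. by apply/asboolP => k; exact: adic_transitionE. Qed.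

Definition to_completion (x : V) : completion := Completion (const_compatible x).

Lemma to_completion_linear : linear to_completion.
Proof.
move=> a x y; apply: val_inj; apply: functional_extensionality_dep => k.
exact: linearP (mpi (adic_sub k)) a x y.
Qed.

HB.instance Definition _ :=
  GRing.isLinear.Build R V completion *:%R to_completion to_completion_linear.

End Objects.

Section Maps.
Variables (V W : lmodType R) (f : {linear V -> W}).

Lemma adic_sub_map k : {in adic_sub V k, forall y, f y \in adic_sub W k}.
Proof.
move=> x /mspanP xS; apply: (xS (mpreim f (adic_sub W k))) => y.
move=> [a [v [ak _ ->]]]; rewrite mem_mpreim linearZ.
by apply: mem_mspan; exists a, (f v).
Qed.

Lemma completion_map_compatible (x : completion V) :
  ((fun k => quotmap (adic_sub W k) f (completion_seq x k)) :
     mprod (fun k => quotmod (adic_sub W k) : lmodType R)) \in @adic_compatible W.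
Proof.
case: x => x xc; have /asboolP hx := xc.
apply/asboolP => k /=; rewrite -(hx k) -[x k.+1]mreprK.
by rewrite adic_transitionE !quotmapE ?adic_transitionE //; exact: adic_sub_map.
Qed.

Definition completion_map (x : completion V) : completion W :=
  Completion (completion_map_compatible x).

Lemma completion_map_linear : linear completion_map.
Proof.
move=> a x y; apply: val_inj; apply: functional_extensionality_dep => k.
exact: (quotmap_linear (@adic_sub_map k)).
Qed.

HB.instance Definition _ := GRing.isLinear.Build R (completion V) (completion W)
  *:%R completion_map completion_map_linear.

End Maps.

Section L0.
Variable M : lmodType R.

(* L0 M = H_0 (completion P) for a projective resolution P of M. H_0 only
   involves P_1 -> P_0 -> M -> 0, for which we take the canonical free
   presentation: P_0 is free on the elements of M and P_1 is free on the
   elements of ker (P_0 -> M). *)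
Definition res0 : lmodType R := {freeg M / R}.

Definition res_aug : {linear res0 -> M} := fglift (id : M -> M).

Definition res1 : lmodType R := {freeg {x : res0 | x \in mker res_aug} / R}.

Definition res_d : {linear res1 -> res0} := fglift val.

Lemma res_aug_gen x : res_aug (fggen R x) = x.
Proof. by rewrite /res_aug /= /fggen liftU scale1r. Qed.

Lemma res_exact : mim res_d =i mker res_aug.
Proof.
move=> x; apply/asboolP/idP => [[y <-]|xK]; last first.
  by exists (fggen R (exist _ x xK)); rewrite /res_d /= /fggen liftU scale1r.
rewrite unfold_in -[y]freeg_sumE !linear_sum big1 // => z _.
have -> : res_d << coeff z y *g z >> = coeff z y *: val z by exact: liftU.
by rewrite linearZ /= (eqP (valP z : res_aug (val z) == 0)) scaler0.
Qed.

Definition L0 : lmodType R := quotmod (mim (completion_map res_d)).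

(* The natural map M = coker (P_1 -> P_0) -> coker (P_1^ -> P_0^) = L0 M
   induced by P_0 -> P_0^; an element x of M is lifted to the corresponding
   generator of P_0. *)
Definition L0_eta (x : M) : L0 :=
  mpi (mim (completion_map res_d)) (to_completion (fggen R x : res0)).

Lemma L0_eta_linear : linear L0_eta.
Proof.
move=> a x y; rewrite /L0_eta -linearP; apply/mpiP; rewrite -linearP -linearB.
set u : res0 := _ - _.
have /asboolP[v <-] : u \in mim res_d.
  by rewrite res_exact unfold_in linearB linearP !res_aug_gen subrr.
apply/asboolP; exists (to_completion v).
apply: val_inj; apply: functional_extensionality_dep => k /=.
by rewrite quotmapE //; exact: adic_sub_map.
Qed.

HB.instance Definition _ :=
  GRing.isLinear.Build R M L0 *:%R L0_eta L0_eta_linear.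

End L0.

Definition L_complete (M : lmodType R) : Prop := bijective (@L0_eta M).

(* Epimorphisms and projective objects of the category of L-complete modules,
   in the categorical sense. *)
Definition Lc_epi (A B : lmodType R) (f : {linear A -> B}) : Prop :=
  forall C : lmodType R, L_complete C ->
  forall g h : {linear B -> C}, g \o f =1 h \o f -> g =1 h.

Definition Lc_projective (P : lmodType R) : Prop :=
  forall A B : lmodType R, L_complete A -> L_complete B ->
  forall (f : {linear A -> B}) (g : {linear P -> B}), Lc_epi f ->
  exists h : {linear P -> A}, f \o h =1 g.

Definition pro_free (M : lmodType R) : Prop :=
  exists2 F : lmodType R, free_module F & lmod_iso M (L0 F).

Definition adic_complete : Prop := bijective (@to_completion R^o).

End Completion.

Section RegularLocal.
Variable R : comNzRingType.

(* The submodules of R^o are the ideals of R, R itself included; idealr and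
   prime_idealr below are the library's proper and prime ideals. *)
Definition noetherian : Prop :=
  forall I : submodClosed R^o, exists s : seq R^o, I =i mspan [set` s].

Definition maximal_ideal (m : idealr R) : Prop :=
  forall J : idealr R, {subset m <= J} -> J =i m.

Definition local_ring (m : idealr R) : Prop :=
  maximal_ideal m /\ forall J : idealr R, maximal_ideal J -> J =i m.

(* p_0 < p_1 < ... < p_n; the values of p beyond n are irrelevant. *)
Definition prime_chain (n : nat) : Prop :=
  exists p : nat -> prime_idealr R, forall i, (i < n)%N ->
    {subset p i <= p i.+1} /\ ~ {subset p i.+1 <= p i}.

Definition krull_dim (d : nat) : Prop := forall n, prime_chain n <-> (n <= d)%N.

(* The maximal ideal is generated by dim R elements. *)
Definition regular_local (m : idealr R) : Prop :=
  [/\ noetherian, local_ring m &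
    exists d (x : 'I_d -> R^o), krull_dim d /\ m =i mspan (range x)].

End RegularLocal.

(* Main.v *)
(** The completion of a free module F is its L_0, and a module N receiving a map
    F -> N that is onto modulo m and injective modulo every m^k satisfies
    L_0 F = L_0 N: surjectivity is Nakayama's lemma for completions, and
    injectivity holds already after composing with L_0 N -> N^.  Applied to
    F -> F^ this shows that F^ is L-complete; applied to a flat N and a basis F
    of N/mN, it shows that L_0 N is pro-free.

    Since L_0 is right exact, cokernels of maps of L-complete modules are
    L-complete, so epimorphisms are surjective and F^ is projective; conversely
    an L-complete M is a quotient of some F^, hence a retract of it if M is
    projective.

    Finally F^ is flat by the equational criterion: its elements are families
    in R tending to 0, so a system of linear equations can be solved coordinate
    by coordinate in its solution module Z inside R^n, and the solutions can be
    made to tend to 0 because the topology of Z induced by R^n is the m-adic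
    one.  For R complete the latter is Chevalley's theorem, which replaces the
    Artin-Rees lemma here. *)

From HB Require Import structures.
From mathcomp Require Import all_boot all_algebra.
From mathcomp Require Import boolp classical_sets.
From mathcomp Require Import freeg.
Require Import Defs.

Set Implicit Arguments.
Unset Strict Implicit.
Unset Printing Implicit Defensive.

Import GRing.Theory.

Local Open Scope ring_scope.

(** * Dependent choice, spans and packaged linear maps *)

Lemma subrBB (V : zmodType) (a b c : V) : (a - b) - (a - c) = c - b.
Proof. by rewrite opprB addrC addrA subrK. Qed.

(** The form needed by successive approximation: [P k] is the invariant at stage k, and [Q k] bounds
    the correction made from stage k to the next. *)
Lemma dependent_choice_seq (T : Type) (P : nat -> T -> Prop)
    (Q : nat -> T -> T -> Prop) x0 :
  P 0%N x0 ->
  (forall k x, P k x -> exists y, P k.+1 y /\ Q k x y) ->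
  exists s : nat -> T, [/\ s 0%N = x0, forall k, P k (s k)
    & forall k, Q k (s k) (s k.+1)].
Proof.
move=> P0 PQ.
have /choice[g gP] (p : nat * T) :
    exists y, P p.1 p.2 -> P p.1.+1 y /\ Q p.1 p.2 y.
  (* Outside [P] the value [p.2] is arbitrary; it only makes [g] total. *)
  by have [/PQ[y ?]|?] := pselect (P p.1 p.2); [exists y | exists p.2].
pose s := fix s k := if k is k'.+1 then g (k', s k') else x0.
have sP k : P k (s k) by elim: k => [//|k /(gP (k, s k))[]].
by exists s; split=> // k; case: (gP (k, s k) (sP k)).
Qed.

Section Span.
Variables (R : comNzRingType) (V : lmodType R).

Lemma submodB (S : submodClosed V) x y : x \in S -> y \in S -> x - y \in S.
Proof. by move=> xS yS; rewrite -scaleN1r rpredD ?rpredZ. Qed.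

Lemma mspan_sub (X : set V) (S : submodClosed V) :
  (forall y, X y -> y \in S) -> {subset mspan X <= S}.
Proof. by move=> XS x /mspanP; apply. Qed.

Lemma mpi_eq0 (S : submodClosed V) x : mpi S x = 0 <-> x \in S.
Proof. by rewrite -(linear0 (mpi S)) -[in X in _ <-> X](subr0 x); exact: mpiP. Qed.

Section MkSub.
Variables (P : V -> Prop) (P0 : P 0) (PD : forall x y, P x -> P y -> P (x + y)).
Variable PZ : forall a x, P x -> P (a *: x).

Definition mksub_pred : {pred V} := fun x => `[< P x >].

Lemma mksub_closed : subsemimod_closed mksub_pred.
Proof.
split; first split.
- exact/asboolP.
- by move=> x y /asboolP hx /asboolP hy; apply/asboolP/PD.
- by move=> a x /asboolP hx; apply/asboolP/PZ.
Qed.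

Definition mksub : submodClosed V :=
  HB.pack mksub_pred (GRing.isSubmodClosed.Build R V mksub_pred mksub_closed).

Lemma mksubP x : reflect (P x) (x \in mksub).
Proof. exact: asboolP. Qed.

(** The predicate [P] is itself a submodule containing [X], so the minimality of the span applies to
    it. *)
Lemma mspan_ind (X : set V) :
  (forall x, X x -> P x) -> forall x, x \in mspan X -> P x.
Proof. by move=> XP x xX; apply/mksubP/(mspan_sub _ xX) => y /XP/mksubP. Qed.

End MkSub.

End Span.

Section MkLin.
Variables (R : comNzRingType) (U V : lmodType R) (f : U -> V).

(** The proof of linearity is an argument so that the linear structure can be attached to the
    constant. *)
Definition mklin_fun (_ : linear f) : U -> V := f.

Variable fL : linear f.

HB.instance Definition _ :=
  GRing.isLinear.Build R U V *:%R (mklin_fun fL) (fL : linear (mklin_fun fL)).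

Definition mklin : {linear U -> V} := mklin_fun fL.

Lemma mklinE x : mklin x = f x. Proof. by []. Qed.

End MkLin.

(** * Free modules and the lifting property *)

Section FreeLift.
Variables (R : comNzRingType) (K : choiceType).
Implicit Types U V : lmodType R.

Lemma fglift_gen V (f : K -> V) k : fglift f (fggen R k) = f k.
Proof. by rewrite /fggen liftU scale1r. Qed.

Lemma freeg_gen_sum (x : {freeg K / R}) :
  x = \sum_(k <- dom x) coeff k x *: fggen R k.
Proof.
rewrite -[LHS]freeg_sumE; apply: eq_bigr => k _.
by apply/eqP/freeg_eqP => k'; rewrite coeffZ !coeffU mul1r.
Qed.

Lemma fglift_sum V (f : K -> V) (x : {freeg K / R}) :
  fglift f x = \sum_(k <- dom x) coeff k x *: f k.
Proof.
rewrite [x in LHS]freeg_gen_sum linear_sum; apply: eq_bigr => k _.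
by rewrite linearZZ; congr (_ *: _); exact: fglift_gen.
Qed.

Lemma freeg_linear_ext V (f g : {linear {freeg K / R} -> V}) :
  (forall k, f (fggen R k) = g (fggen R k)) -> f =1 g.
Proof.
move=> fg x; rewrite [x]freeg_gen_sum !linear_sum.
by apply: eq_bigr => k _; rewrite !linearZ fg.
Qed.

Lemma freeg_lift U V (d : {linear U -> V})
    (h : {linear {freeg K / R} -> V}) :
  (forall k, exists u, d u = h (fggen R k)) ->
  exists t : {linear {freeg K / R} -> U}, forall x, d (t x) = h x.
Proof.
move=> /choice[t tP]; exists (fglift t).
apply: (@freeg_linear_ext V (d \o fglift t) h) => k.
exact: etrans (congr1 d (fglift_gen t k)) (tP k).
Qed.

End FreeLift.

Section LiftProperty.
Variable R : comNzRingType.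

(** Projectivity in Mod_R. Instead of [g] being surjective, only the image of [h] has to lie in that
    of [g], which amounts to the same after replacing the target by the image of [g]. *)
Definition lifting (F : lmodType R) : Prop :=
  forall (A B : lmodType R) (g : {linear A -> B}) (h : {linear F -> B}),
    (forall x, exists a, g a = h x) ->
    exists t : {linear F -> A}, forall x, g (t x) = h x.

Lemma freeg_lifting (K : choiceType) : lifting {freeg K / R}.
Proof. by move=> A B g h gh; apply: freeg_lift. Qed.

Lemma bijective_linear_inv (U V : lmodType R) (f : {linear U -> V}) :
  bijective f -> exists2 g : {linear V -> U}, cancel f g & cancel g f.
Proof.
move=> [g fK gK]; have gL : linear g.
  by move=> a x y; apply: (can_inj fK); rewrite linearP !gK.
by exists (mklin gL).
Qed.

Lemma free_module_lifting (F : lmodType R) : free_module F -> lifting F.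
Proof.
move=> [K [f /bijective_linear_inv[g fK gK]]] A B p h ph.
have [//|t tP] := @freeg_lifting K A B p (h \o g) => [x|]; first exact: ph.
by exists (t \o f) => x /=; rewrite tP /= fK.
Qed.

Lemma linear_inj (U V : lmodType R) (f : {linear U -> V}) :
  (forall x, f x = 0 -> x = 0) -> injective f.
Proof.
move=> f0 x y fxy; apply/eqP; rewrite -subr_eq0; apply/eqP/f0.
by rewrite linearB fxy subrr.
Qed.

Lemma inj_surj_bij (U V : Type) (f : U -> V) :
  injective f -> (forall y, exists x, f x = y) -> bijective f.
Proof. by move=> fI /choice[g gK]; exists g => // x; apply: fI; rewrite gK. Qed.

End LiftProperty.

(** * Adic filtrations and completion *)

Section Adic.
Variables (R : comNzRingType) (m : {pred R}).
Local Notation cmap := (@completion_map R m _ _).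

Lemma ideal_pow_closed k :
  subsemimod_closed (V := R^o) (ideal_pow m k : {pred R^o}).
Proof. by case: k => [//|k]; exact: mspan_closed. Qed.

Lemma ideal_powZ k a b : b \in ideal_pow m k -> a * b \in ideal_pow m k.
Proof. exact: (ideal_pow_closed k).2. Qed.

Lemma ideal_pow0 k : 0 \in ideal_pow m k.
Proof. exact: (ideal_pow_closed k).1.1. Qed.

Lemma ideal_powD k a b :
  a \in ideal_pow m k -> b \in ideal_pow m k -> a + b \in ideal_pow m k.
Proof. exact: (ideal_pow_closed k).1.2. Qed.

Lemma ideal_powN k a : a \in ideal_pow m k -> - a \in ideal_pow m k.
Proof. by move=> ak; rewrite -mulN1r ideal_powZ. Qed.

Lemma ideal_powB k a b :
  a \in ideal_pow m k -> b \in ideal_pow m k -> a - b \in ideal_pow m k.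
Proof. by move=> ak bk; rewrite ideal_powD // ideal_powN. Qed.

Lemma ideal_pow_sum k (I : Type) (r : seq I) (P : pred I) (F : I -> R) :
  (forall i, P i -> F i \in ideal_pow m k) ->
  \sum_(i <- r | P i) F i \in ideal_pow m k.
Proof.
move=> Fk; elim/big_ind: _ => //; [exact: ideal_pow0 | exact: ideal_powD].
Qed.

Lemma ideal_powM i j a b :
  a \in ideal_pow m i -> b \in ideal_pow m j -> a * b \in ideal_pow m (i + j).
Proof.
move=> ai bj; elim: i a ai => [|i IH] a ai; first exact: ideal_powZ.
apply: (@mspan_ind R R^o (fun a : R => a * b \in ideal_pow m (i.+1 + j)) _ _ _ _ _ _ ai).
- by rewrite mul0r ideal_pow0.
- by move=> x y xb yb; rewrite mulrDl ideal_powD.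
- by move=> c x xb; rewrite -mulrA ideal_powZ.
- move=> _ [c [x [cm xi ->]]]; apply: mem_mspan; exists c, (x * b).
  by split=> //; [exact: IH | rewrite /GRing.scale /= mulrA].
Qed.

Lemma ideal_pow_le i j : (i <= j)%N -> {subset ideal_pow m j <= ideal_pow m i}.
Proof.
by move=> /subnK <- a; elim: (j - i)%N => [//|n IH] /ideal_powS/IH.
Qed.

Section AdicSub.
Variable V : lmodType R.

Lemma adic_sub0 v : v \in adic_sub m V 0.
Proof. by apply: mem_mspan; exists 1, v; rewrite scale1r. Qed.

Lemma mem_adic_sub k a v : a \in ideal_pow m k -> a *: v \in adic_sub m V k.
Proof. by move=> ak; apply: mem_mspan; exists a, v. Qed.

(** Scalars are absorbed by the coefficient in m^k, so every element of m^k V is a finite sum of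
    products a v; closure of [P] under scalars need not be proved. *)
Lemma adic_sub_ind (P : V -> Prop) k :
  P 0 -> (forall x y, P x -> P y -> P (x + y)) ->
  (forall a x, a \in ideal_pow m k -> P (a *: x)) ->
  forall x, x \in adic_sub m V k -> P x.
Proof.
move=> P0 PD PZ x xk.
have : exists s : seq (R * V), (forall p, p \in s -> p.1 \in ideal_pow m k) /\
    x = \sum_(p <- s) p.1 *: p.2.
  apply: (mspan_ind (P := fun x => exists s : seq (R * V),
     (forall p, p \in s -> p.1 \in ideal_pow m k) /\
     x = \sum_(p <- s) p.1 *: p.2) _ _ _ _ xk).
  - by exists [::]; rewrite big_nil.
  - move=> _ _ [s [sk ->]] [t [tk ->]]; exists (s ++ t); rewrite big_cat; split=> //.
    by move=> p; rewrite mem_cat => /orP[/sk|/tk].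
  - move=> a _ [s [sk ->]]; exists [seq (a * p.1, p.2) | p <- s].
    rewrite big_map scaler_sumr; split.
      by move=> _ /mapP[p /sk pk ->]; exact: ideal_powZ.
    by apply: eq_bigr => p _; rewrite scalerA.
  - move=> _ [a [v [ak _ ->]]]; exists [:: (a, v)]; rewrite big_seq1; split=> //.
    by move=> p; rewrite inE => /eqP->.
move=> [s [sk ->]]; rewrite big_seq_cond; elim/big_ind: _ => // p.
by rewrite andbT => /sk/PZ.
Qed.

Lemma adic_subM i j a v :
  a \in ideal_pow m i -> v \in adic_sub m V j -> a *: v \in adic_sub m V (i + j).
Proof.
move=> ai; apply: (adic_sub_ind (P := fun v => a *: v \in adic_sub m V (i + j))).
- by rewrite scaler0 rpred0.
- by move=> x y ax ay; rewrite scalerDr rpredD.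
- by move=> b x bj; rewrite scalerA mem_adic_sub // ideal_powM.
Qed.

End AdicSub.

Lemma adic_sub_regular k (a : R) : (a \in adic_sub m R^o k) = (a \in ideal_pow m k).
Proof.
apply/idP/idP => [|ak]; last by rewrite -[a]mulr1; exact: (mem_adic_sub (V := R^o)).
apply: (adic_sub_ind (V := R^o) (P := fun a : R => a \in ideal_pow m k)).
- exact: ideal_pow0.
- exact: ideal_powD.
- by move=> b x bk; rewrite /GRing.scale /= mulrC ideal_powZ.
Qed.

Section CompletionElements.
Variable V : lmodType R.

Lemma completion_ext (x y : completion m V) :
  (forall k, completion_seq x k = completion_seq y k) -> x = y.
Proof.
by move=> xy; apply: val_inj; apply: functional_extensionality_dep => k; exact: xy.
Qed.

Definition completion_rep (x : completion m V) k : V := mrepr (completion_seq x k).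

Lemma completion_repK x k :
  mpi (adic_sub m V k) (completion_rep x k) = completion_seq x k.
Proof. exact: mreprK. Qed.

Lemma completion_repS x k :
  completion_rep x k.+1 - completion_rep x k \in adic_sub m V k.
Proof.
apply/mpiP; rewrite completion_repK -adic_transitionE completion_repK.
by have /asboolP := completionP x; exact.
Qed.

Section OfSeq.
Variables (u : nat -> V) (uS : forall k, u k.+1 - u k \in adic_sub m V k).

Lemma completion_of_seq_subproof :
  ((fun k => mpi (adic_sub m V k) (u k)) :
     mprod (fun k => quotmod (adic_sub m V k) : lmodType R)) \in @adic_compatible R m V.
Proof. by apply/asboolP => k; rewrite adic_transitionE; apply/mpiP. Qed.

Definition completion_of_seq := Completion completion_of_seq_subproof.

End OfSeq.

Lemma to_completion_eq0 v :
  to_completion m v = 0 <-> forall k, v \in adic_sub m V k.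
Proof.
split=> [v0 k|v0]; last by apply: completion_ext => k; apply/mpi_eq0.
by apply/mpi_eq0; have /(congr1 (fun x => completion_seq x k)) := v0.
Qed.

End CompletionElements.

Section CompletionMaps.
Implicit Types U V W : lmodType R.

Lemma completion_mapE V W (f : {linear V -> W}) x k :
  completion_seq (cmap f x) k
    = mpi (adic_sub m W k) (f (completion_rep x k)).
Proof. by []. Qed.

Lemma completion_map_seq V W (f : {linear V -> W}) x k v :
  completion_seq x k = mpi (adic_sub m V k) v ->
  completion_seq (cmap f x) k = mpi (adic_sub m W k) (f v).
Proof. by move=> /= ->; apply: quotmapE; exact: adic_sub_map. Qed.

Lemma completion_map_ext V W (f g : {linear V -> W}) :
  f =1 g -> cmap f =1 cmap g.
Proof. by move=> fg x; apply: completion_ext => k; rewrite !completion_mapE fg. Qed.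

Lemma completion_map_comp U V W (f : {linear U -> V}) (g : {linear V -> W}) x :
  cmap (g \o f) x = cmap g (cmap f x).
Proof.
by apply: completion_ext => k; rewrite (completion_map_seq g (completion_mapE f x k)).
Qed.

Lemma completion_map_to_completion V W (f : {linear V -> W}) v :
  cmap f (to_completion m v) = to_completion m (f v).
Proof. by apply: completion_ext => k; exact: completion_map_seq. Qed.

Lemma completion_map_id V (f : {linear V -> V}) :
  f =1 id -> cmap f =1 id.
Proof.
by move=> fid x; apply: completion_ext => k; rewrite completion_mapE fid completion_repK.
Qed.

Lemma completion_map_add U V W (f : {linear U -> W}) (g : {linear V -> W})
    (h : {linear U -> W}) (t : {linear U -> V}) x :
  (forall x, h x = f x + g (t x)) ->
  cmap h x = cmap f x + cmap g (cmap t x).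
Proof.
move=> hE; apply: completion_ext => k; rewrite -completion_map_comp.
rewrite completion_mapE hE linearD; exact: congr2.
Qed.

Lemma completion_map_pair U V W (f : {linear U -> W}) (g : {linear V -> W})
    (h : {linear (U * V)%type -> W}) x :
  (forall x, h x = f x.1 + g x.2) ->
  exists u v, cmap h x = cmap f u + cmap g v.
Proof.
move=> hE; pose p1 : {linear (U * V)%type -> U} := fst.
pose p2 : {linear (U * V)%type -> V} := snd.
exists (cmap p1 x), (cmap p2 x).
rewrite -completion_map_comp; apply: completion_map_add => y.
by rewrite hE.
Qed.

(* Successive approximation: m^k V = m^k f(U) + m^(k+1) V. *)
Lemma completion_map_surj U V (f : {linear U -> V}) :
  (forall v, exists u, v - f u \in adic_sub m V 1) ->
  forall y, exists x, cmap f x = y.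
Proof.
move=> fsurj y.
have step k w : w \in adic_sub m V k ->
    exists2 u, u \in adic_sub m U k & w - f u \in adic_sub m V k.+1.
  apply: (adic_sub_ind (P := fun w => exists2 u, u \in adic_sub m U k
    & w - f u \in adic_sub m V k.+1)) => [|x x' [u uk xu] [u' uk' xu']|a x ak].
  - exists 0; first exact: rpred0.
    by rewrite linear0 subr0 rpred0.
  - exists (u + u'); first exact: rpredD.
    by rewrite linearD opprD addrACA rpredD.
  - have [u xu] := fsurj x; exists (a *: u); first exact: mem_adic_sub.
    by rewrite linearZ -scalerBr -addn1 adic_subM.
pose v := completion_rep y.
have [|k u uk|s [_ s1 s2]] := @dependent_choice_seq U
  (fun k u => v k - f u \in adic_sub m V k)
  (fun k u u' => u' - u \in adic_sub m U k) 0; first exact: adic_sub0.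
  have [|d dk fd] := step k (v k.+1 - f u).
    by rewrite -(subrK (v k) (v k.+1)) -addrA rpredD // completion_repS.
  exists (u + d); split; last by rewrite addrC addKr.
  by rewrite linearD opprD addrA.
exists (completion_of_seq s2); apply: completion_ext => k.
rewrite (@completion_map_seq _ _ _ _ _ (s k)) // -completion_repK; apply/mpiP.
by rewrite -rpredN opprB.
Qed.

(** Completion is not exact, but the source is free: [u] and [v] chosen on generators extend to a
    linear map into the product of [U] and [V], and this factorization survives completion. *)
Lemma completion_map_factor (K : choiceType) U V W (e : {linear U -> W})
    (d : {linear V -> W}) (h : {linear {freeg K / R} -> W}) :
  (forall k, exists u v, h (fggen R k) = e u + d v) ->
  forall p, exists u v,
    cmap h p = cmap e u + cmap d v.
Proof.
move=> hE p.
have edL : linear (fun x : U * V => e x.1 + d x.2).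
  by move=> a x y; rewrite !linearP /= scalerDr addrACA.
have [k|t tP] := @freeg_lift R K _ _ (mklin edL) h.
  by have [u [v ->]] := hE k; exists (u, v).
have -> : cmap h p = cmap (mklin edL) (cmap t p).
  by rewrite -completion_map_comp; apply: completion_map_ext => x; rewrite /= -tP.
exact: completion_map_pair.
Qed.

End CompletionMaps.
End Adic.

(** * The functor L_0 *)

Section DerivedCompletion.
Variables (R : comNzRingType) (m : {pred R}).
Implicit Types A B C M N U V : lmodType R.
Local Notation cmap := (@completion_map R m _ _).

Lemma mem_mim U V (f : {linear U -> V}) x : f x \in mim f.
Proof. by apply/asboolP; exists x. Qed.

Lemma res_dP M x : res_aug M x = 0 -> exists y, res_d M y = x.
Proof.
by move=> x0; have /asboolP : x \in mim (res_d M) by rewrite res_exact unfold_in x0.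
Qed.

Lemma res_aug_d M x : res_aug M (res_d M x) = 0.
Proof.
have : res_d M x \in mker (res_aug M) by rewrite -res_exact mem_mim.
by move/eqP.
Qed.

Lemma adic_sub_lift U V (g : {linear U -> V}) k :
  (forall v, exists u, g u = v) ->
  forall v, v \in adic_sub m V k -> exists2 u, u \in adic_sub m U k & g u = v.
Proof.
move=> gsurj; apply: (adic_sub_ind (P := fun v => exists2 u,
  u \in adic_sub m U k & g u = v)) => [|_ _ [u uk <-] [u' uk' <-]|a v ak].
- by exists 0; [exact: rpred0 | exact: linear0].
- by exists (u + u'); [exact: rpredD | exact: linearD].
- by have [u <-] := gsurj v; exists (a *: u); [exact: mem_adic_sub | exact: linearZ].
Qed.

(** The lift of [f] to the degree 0 terms of the canonical resolutions. *)
Definition resmap M N (f : {linear M -> N}) : {linear res0 M -> res0 N} :=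
  fglift (fun x => fggen R (f x)).

Lemma resmap_gen M N (f : {linear M -> N}) x :
  resmap f (fggen R x) = fggen R (f x).
Proof. exact: (fglift_gen (fun x => fggen R (f x))). Qed.

Lemma res_aug_resmap M N (f : {linear M -> N}) x :
  res_aug N (resmap f x) = f (res_aug M x).
Proof.
apply: (freeg_linear_ext (f := res_aug N \o resmap f) (g := f \o res_aug M)) => k.
by rewrite /= resmap_gen !res_aug_gen.
Qed.

Lemma res_decomp M N (f : {linear M -> N}) x a :
  res_aug N x = f a -> exists v, x = resmap f (fggen R a) + res_d N v.
Proof.
move=> xa; have [|v vE] := @res_dP N (x - resmap f (fggen R a)).
  by rewrite linearB res_aug_resmap res_aug_gen xa subrr.
by exists v; rewrite vE addrC subrK.
Qed.

(** As [res1 M] is free and [resmap f] sends boundaries to cycles, [resmap f \o res_d M] factors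
    through [res_d N]; completing this factorization gives the claim. *)
Lemma resmap_boundary M N (f : {linear M -> N}) :
  {in mim (cmap (res_d M)), forall y, cmap (resmap f) y \in mim (cmap (res_d N))}.
Proof.
move=> _ /asboolP[y <-].
have [k|t tP] := @freeg_lift R _ _ _ (res_d N) (resmap f \o res_d M).
  by apply: res_dP; rewrite /= res_aug_resmap res_aug_d linear0.
rewrite -completion_map_comp -(completion_map_ext (f := res_d N \o t)) //.
by rewrite completion_map_comp mem_mim.
Qed.

Definition L0_map M N (f : {linear M -> N}) : {linear L0 m M -> L0 m N} :=
  mklin (quotmap_linear (@resmap_boundary M N f)).

Lemma L0_mapE M N (f : {linear M -> N}) x :
  L0_map f (mpi _ x) = mpi (mim (cmap (res_d N))) (cmap (resmap f) x).
Proof. exact: quotmapE (@resmap_boundary M N f). Qed.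

Lemma L0_ind M (P : L0 m M -> Prop) :
  (forall x, P (mpi (mim (cmap (res_d M))) x)) -> forall q, P q.
Proof. by move=> PP q; rewrite -[q]mreprK. Qed.

Lemma L0_eq M x y u :
  x = y + cmap (res_d M) u ->
  mpi (mim (cmap (res_d M))) x = mpi (mim (cmap (res_d M))) y.
Proof. by move=> ->; apply/mpiP; rewrite addrC addKr mem_mim. Qed.

Lemma L0_map_comp M N V (f : {linear M -> N}) (g : {linear N -> V}) q :
  L0_map (g \o f) q = L0_map g (L0_map f q).
Proof.
elim/L0_ind: q => x; rewrite !L0_mapE -completion_map_comp; congr (mpi _ _).
apply: completion_map_ext.
apply: (freeg_linear_ext (g := resmap g \o resmap f)) => k.
by rewrite resmap_gen [RHS](congr1 (resmap g) (resmap_gen f k)) resmap_gen.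
Qed.

Lemma L0_map_eta M N (f : {linear M -> N}) x :
  L0_map f (L0_eta m x) = L0_eta m (f x).
Proof. by rewrite L0_mapE completion_map_to_completion resmap_gen. Qed.

(** The lift [resmap f] need not vanish: it sends every generator to the generator at 0. That
    element is a boundary, so the completed lift takes values in completed boundaries. *)
Lemma L0_map_zero M N (f : {linear M -> N}) :
  (forall x, f x = 0) -> forall q, L0_map f q = 0.
Proof.
move=> f0; elim/L0_ind => x; rewrite L0_mapE.
have [k|u [v ->]] :=
    @completion_map_factor R m _ _ _ _ (res_d N) (res_d N) (resmap f) _ x.
  have [|u uE] := @res_dP N (resmap f (fggen R k)).
    by rewrite res_aug_resmap f0.
  by exists u, 0; rewrite linear0 addr0.
rewrite -linearD -[RHS](linear0 (mpi _)); apply: (@L0_eq _ _ _ (u + v)).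
by rewrite add0r.
Qed.

(** Nakayama for L_0: [resmap f] and [res_d N] together are onto [res0 N] modulo m, hence onto after
    completion, and the contribution of [res_d N] vanishes in L_0. *)
Lemma L0_map_surj M N (f : {linear M -> N}) :
  (forall y, exists x, y - f x \in adic_sub m N 1) ->
  forall q, exists p, L0_map f p = q.
Proof.
move=> fsurj; elim/L0_ind => y.
have edL : linear (fun x : res0 M * res1 N => resmap f x.1 + res_d N x.2).
  by move=> a x z; rewrite !linearP /= scalerDr addrACA.
have [v|p <-] := @completion_map_surj R m _ _ (mklin edL) _ y.
  have [a afv] := fsurj (res_aug N v).
  (* The error of [f a] in m N is lifted to [w] in m P_0; then [v - w] lies exactly over [f a]. *)
  have [|w w1 wE] := @adic_sub_lift _ _ (res_aug N) _ _ _ afv.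
    by move=> z; exists (fggen R z); exact: res_aug_gen.
  have [|u uE] := @res_decomp M N f (v - w) a.
    by rewrite linearB wE subKr.
  by exists (fggen R a, u); rewrite mklinE /= -uE subKr.
have [//|u [v ->]] := @completion_map_pair R m _ _ _ (resmap f) (res_d N) (mklin edL) p.
by exists (mpi _ u); rewrite L0_mapE; apply/esym/(@L0_eq _ _ _ v).
Qed.

(** Let [s] lift a set-theoretic section of [p] to the resolutions. Both z - s (resmap p z) and the
    values of [s \o res_d C] lie over ker p = im f, so on generators they are sums of a value of
    [resmap f] and a boundary. This persists after completion, where [resmap p] sends [x] to a
    boundary. *)
Lemma L0_right_exact A B C (f : {linear A -> B}) (p : {linear B -> C}) :
  (forall c, exists b, p b = c) -> (forall b, p b = 0 -> exists a, f a = b) ->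
  forall q, L0_map p q = 0 -> exists a, L0_map f a = q.
Proof.
move=> /choice[s0 s0P] exf; elim/L0_ind => x.
rewrite L0_mapE => /mpi_eq0/asboolP[y yE].
pose s : {linear res0 C -> res0 B} := fglift (fun c => fggen R (s0 c)).
have sE c : p (res_aug B (s c)) = res_aug C c.
  apply: (freeg_linear_ext (f := p \o res_aug B \o s) (g := res_aug C)) => k /=.
  by rewrite res_aug_gen /s fglift_gen res_aug_gen s0P.
have fdec z : p (res_aug B z) = 0 -> exists u v, z = resmap f u + res_d B v.
  by move=> /exf[a aE]; exists (fggen R a); apply: res_decomp.
pose h : {linear res0 B -> res0 B} := idfun \- (s \o resmap p).
have hE z : h z = z - s (resmap p z) by [].
have [|u1 [v1 E1]] := @completion_map_factor R m _ _ _ _ (resmap f) (res_d B) h _ x.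
  move=> b; apply: fdec.
  by rewrite hE !linearB sE res_aug_resmap subrr.
have [|u2 [v2 E2]] :=
    @completion_map_factor R m _ _ _ _ (resmap f) (res_d B) (s \o res_d C) _ y.
  by move=> b; apply: fdec; rewrite /= sE res_aug_d.
exists (mpi _ (u1 + u2)); rewrite L0_mapE; apply/esym/(@L0_eq _ _ _ (v1 + v2)).
rewrite -[x](completion_map_id (f := idfun : {linear res0 B -> res0 B})) //.
rewrite (@completion_map_add R m _ _ _ h s idfun (resmap p)); last first.
  by move=> z; rewrite hE subrK.
by rewrite -yE -completion_map_comp E1 E2 !linearD addrACA.
Qed.

(** The comparison map from L_0 M to the completion of M induced by the augmentation; [L0_epsE]
    shows independence of the representative. *)
Definition L0_eps M (q : L0 m M) : completion m M := cmap (res_aug M) (mrepr q).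

Lemma L0_epsE M x : L0_eps (mpi _ x) = cmap (res_aug M) x.
Proof.
have /mpiP/asboolP[y yE] := mreprK (mpi (mim (cmap (res_d M))) x).
apply/eqP; rewrite -subr_eq0; apply/eqP.
transitivity (cmap (res_aug M \o res_d M) y).
  rewrite completion_map_comp; apply/esym.
  exact: etrans (congr1 (cmap (res_aug M)) yE) (linearB (cmap (res_aug M)) _ _).
apply: completion_ext => k; rewrite completion_mapE /= res_aug_d.
exact: linear0.
Qed.

Lemma L0_eps_linear M : linear (@L0_eps M).
Proof.
move=> a; elim/L0_ind => x; elim/L0_ind => y.
by rewrite -linearP !L0_epsE linearP.
Qed.

HB.instance Definition _ M :=
  GRing.isLinear.Build R (L0 m M) (completion m M) *:%R (@L0_eps M) (@L0_eps_linear M).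

Lemma L0_eps_eta M x : L0_eps (L0_eta m x) = to_completion m (x : M).
Proof. by rewrite L0_epsE completion_map_to_completion res_aug_gen. Qed.

Lemma L0_eps_map M N (f : {linear M -> N}) q :
  L0_eps (L0_map f q) = cmap f (L0_eps q).
Proof.
elim/L0_ind: q => x; rewrite L0_mapE !L0_epsE -!completion_map_comp.
by apply: completion_map_ext => y; rewrite /= res_aug_resmap.
Qed.

Lemma L0_eps_surj M y : exists q : L0 m M, L0_eps q = y.
Proof.
have [v|x <-] := @completion_map_surj R m _ _ (res_aug M) _ y.
  by exists (fggen R v); rewrite res_aug_gen subrr rpred0.
by exists (mpi _ x); exact: L0_epsE.
Qed.

(** A section [s] of the augmentation makes id - s aug take values in the boundaries, so it lifts to
    [t] with id = d t + s aug. After completion, an element killed by the augmentation is therefore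
    a boundary. *)
Lemma L0_eps_inj M : lifting M -> injective (@L0_eps M).
Proof.
move=> liftM; apply: linear_inj; elim/L0_ind => x /(etrans (esym (L0_epsE x))) x0.
have [y|s sE] := liftM _ _ (res_aug M) idfun.
  by exists (fggen R y); rewrite res_aug_gen.
pose h : {linear res0 M -> res0 M} := idfun \- (s \o res_aug M).
have hE z : h z = z - s (res_aug M z) by [].
have [k|t tP] := @freeg_lift R _ _ _ (res_d M) h.
  by apply: res_dP; rewrite hE !linearB sE subrr.
rewrite -[RHS](linear0 (mpi _)); apply: (@L0_eq _ _ _ (cmap t x)).
rewrite -[LHS](completion_map_id (f := idfun : {linear res0 M -> res0 M})) //.
rewrite (@completion_map_add R m _ _ _ h s idfun (res_aug M)); last first.
  by move=> z; rewrite hE subrK.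
rewrite x0 linear0 addr0 add0r -completion_map_comp.
by apply: completion_map_ext => z; rewrite -tP.
Qed.

Lemma L0_eps_bij M : lifting M -> bijective (@L0_eps M).
Proof. by move=> liftM; apply: inj_surj_bij (L0_eps_surj (M:=M)); exact: L0_eps_inj. Qed.

(** A five lemma argument: L_0 preserves the cokernel by right exactness, and [L0_eta] is bijective
    on [A] and [B]. *)
Lemma cokernel_L_complete A B (f : {linear A -> B}) :
  L_complete m A -> L_complete m B -> L_complete m (quotmod (mim f)).
Proof.
move=> [etaA' _ etaAK] [etaB' etaBK' etaBK].
pose p : {linear B -> quotmod (mim f)} := mpi (mim f).
have psurj c : exists b, p b = c by exists (mrepr c); exact: mreprK.
have p0 b : p b = 0 <-> exists a, f a = b.
  by split=> [/mpi_eq0/asboolP|[a <-]] //; apply/mpi_eq0/mem_mim.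
apply: inj_surj_bij => [|q].
  apply: linear_inj => c; have [b <-] := psurj c => /(etrans (L0_map_eta p b)) eb0.
  have [b'|a aE] := @L0_right_exact _ _ _ f p psurj _ _ eb0; first by move/p0.
  apply/p0; exists (etaA' a); apply: (can_inj etaBK').
  by rewrite -L0_map_eta etaAK.
have [y|x <-] := @L0_map_surj _ _ p _ q.
  by have [x <-] := psurj y; exists x; rewrite subrr rpred0.
by exists (p (etaB' x)); rewrite -L0_map_eta etaBK.
Qed.

(** The cokernel is an admissible test object, and there the projection and the zero map agree after
    composition with [f]. *)
Lemma Lc_epi_surj A B (f : {linear A -> B}) :
  L_complete m A -> L_complete m B -> Lc_epi m f ->
  forall b, exists a, f a = b.
Proof.
move=> Ac Bc /(_ _ (cokernel_L_complete f Ac Bc)) epi b.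
have /(_ b) : mpi (mim f) =1 (\0 : {linear B -> quotmod (mim f)}).
  by apply: epi => a; apply/mpi_eq0/mem_mim.
by move/mpi_eq0/asboolP.
Qed.

End DerivedCompletion.

(** * The adic filtration of a finitely generated ideal *)

Lemma mspan_rangeP (R : comNzRingType) (V : lmodType R) (K : finType) (b : K -> V) v :
  v \in mspan (range b) -> exists c : K -> R, v = \sum_i c i *: b i.
Proof.
move=> vb; apply: (mspan_ind (P := fun v => exists c : K -> R,
  v = \sum_i c i *: b i) _ _ _ _ vb).
- by exists (fun=> 0); rewrite big1 // => i _; rewrite scale0r.
- move=> _ _ [c ->] [d ->]; exists (fun i => c i + d i).
  by rewrite -big_split; apply: eq_bigr => i _; rewrite scalerDl.
- move=> a _ [c ->]; exists (fun i => a * c i).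
  by rewrite scaler_sumr; apply: eq_bigr => i _; rewrite scalerA.
- move=> _ [i _ <-]; exists (fun j => (j == i)%:R).
  rewrite (bigD1 i) //= eqxx scale1r big1 ?addr0 // => j /negPf ->.
  by rewrite scale0r.
Qed.

Section AdicSubGenerators.
Variables (R : comNzRingType) (m : {pred R}) (d : nat) (x : 'I_d -> R^o).
Hypothesis mE : m =i mspan (range x).

Lemma ideal_gen_mem i : x i \in m.
Proof. by rewrite mE; apply: mem_mspan; exists i. Qed.

(** The same finitely many generators serve for every [v] and [k], which lets infinitely many
    corrections be collected into one series per generator. *)
Lemma adic_subS_decomp (V : lmodType R) k (v : V) : v \in adic_sub m V k.+1 ->
  exists w : 'I_d -> V,
    (forall i, w i \in adic_sub m V k) /\ v = \sum_i (x i : R) *: w i.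
Proof.
pose P (v : V) := exists w : 'I_d -> V,
    (forall i, w i \in adic_sub m V k) /\ v = \sum_i (x i : R) *: w i.
have P0 : P 0.
  by exists (fun=> 0); split=> [i|]; rewrite ?rpred0 // big1 // => i _; rewrite scaler0.
have PD u w : P u -> P w -> P (u + w).
  move=> [a [ak ->]] [b [bk ->]]; exists (fun i => a i + b i); split.
    by move=> i; rewrite rpredD.
  by rewrite -big_split; apply: eq_bigr => i _; rewrite scalerDr.
have PZ c u : P u -> P (c *: u).
  move=> [a [ak ->]]; exists (fun i => c *: a i); split.
    by move=> i; rewrite rpredZ.
  by rewrite scaler_sumr; apply: eq_bigr => i _; rewrite !scalerA mulrC.
apply: (adic_sub_ind (P := P)) => // a u ak.
apply: (@mspan_ind R R^o (fun a : R => P (a *: u)) _ _ _ _ _ _ ak).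
- by rewrite scale0r.
- by move=> b c; rewrite scalerDl; exact: PD.
- by move=> b c /(PZ b); rewrite scalerA.
- move=> _ [b [c [bm ck ->]]]; rewrite mE in bm.
  have [e ->] := mspan_rangeP bm; exists (fun i => (e i * c) *: u); split.
    by move=> i; rewrite mem_adic_sub // ideal_powZ.
  rewrite [_ *: c]mulr_suml scaler_suml; apply: eq_bigr => i _.
  by rewrite scalerA; congr (_ *: _); rewrite [_ *: x i]mulrC -mulrA.
Qed.

End AdicSubGenerators.

(** * L-completeness of completions *)

Section CompletionOfModule.
Variables (R : comNzRingType) (m : {pred R}) (d : nat) (x : 'I_d -> R^o).
Hypothesis mE : m =i mspan (range x).
Implicit Types A B F M U V : lmodType R.
Local Notation cmap := (@completion_map R m _ _).

Section Projection.
Variables (V : lmodType R) (k : nat).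

Definition completion_proj (y : completion m V) : quotmod (adic_sub m V k) :=
  completion_seq y k.

Lemma completion_proj_linear : linear completion_proj.
Proof. by []. Qed.

HB.instance Definition _ :=
  GRing.isLinear.Build R (completion m V) (quotmod (adic_sub m V k)) *:%R
    completion_proj completion_proj_linear.

Lemma completion_proj_adic y :
  y \in adic_sub m (completion m V) k -> completion_proj y = 0.
Proof.
apply: (adic_sub_ind (P := fun y => completion_proj y = 0)) => [|u z u0 z0|a z ak].
- exact: linear0.
- by rewrite linearD [X in X + _]u0 [X in _ + X]z0 addr0.
- rewrite linearZ /= -[completion_proj z]mreprK -linearZ /=.
  exact/mpi_eq0/mem_adic_sub.
Qed.

End Projection.

(** With representatives v_k of y, the difference y - v_1 is the sum of the increments v_(k+1) - v_k
    for k > 0. Each is a combination of the generators of m with coefficients in m^(k-1) V; summing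
    these coefficients over k gives elements [W i] of the completion. *)
Lemma to_completion_dense V (y : completion m V) :
  exists v, y - to_completion m v \in adic_sub m (completion m V) 1.
Proof.
pose v := completion_rep y.
(* The index of [v] runs one ahead of that of [w], since dividing by the generators costs one power
   of m. *)
have [|k w vw|s [_ s1 s2]] := @dependent_choice_seq ('I_d -> V)
  (fun k w => v k.+1 - v 1 - \sum_i (x i : R) *: w i \in adic_sub m V k.+1)
  (fun k w w' => forall i, w' i - w i \in adic_sub m V k) (fun=> 0).
- by rewrite subrr sub0r rpredN big1 ?rpred0 // => i _; rewrite scaler0.
- set r := (X in X \in _) in vw.
  have [|e [ek eE]] := @adic_subS_decomp _ _ _ _ mE _ k (v k.+2 - v k.+1 + r).
    by rewrite rpredD // completion_repS.
  exists (fun i => w i + e i); split=> [|i]; last by rewrite addrC addKr.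
  under eq_bigr do rewrite scalerDr.
  have rE : v k.+2 - v k.+1 + r = v k.+2 - v 1 - \sum_i (x i : R) *: w i.
    by rewrite /r -!addrA addKr.
  by rewrite big_split /= -eE rE [X in _ - X]addrC subrK subrr rpred0.
exists (v 1%N).
pose W i := completion_of_seq (fun k => s2 k i).
have -> : y - to_completion m (v 1) = \sum_i (x i : R) *: W i.
  apply: completion_ext => k.
  rewrite -[RHS]/(completion_proj k _) linear_sum.
  transitivity (mpi (adic_sub m V k) (v k - v 1%N)).
    apply/esym/(etrans (linearB (mpi (adic_sub m V k)) _ _)).
    by rewrite /= completion_repK.
  transitivity (mpi (adic_sub m V k) (\sum_i (x i : R) *: s k i)).
    set S := \sum_i _; apply/mpiP.
    have -> : v k - v 1%N - S = v k.+1 - v 1%N - S - (v k.+1 - v k).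
      by rewrite opprB [RHS]addrC -!addrA addKr.
    rewrite rpredD //; first exact/adic_subS/s1.
    by rewrite rpredN completion_repS.
  by rewrite linear_sum; apply: eq_bigr => i _; rewrite !linearZ.
rewrite rpred_sum // => i _; apply: mem_adic_sub.
have := @ideal_powM R m 1 0 (x i) 1; rewrite mulr1; apply=> //.
by apply: mem_mspan; exists (x i), 1; rewrite (ideal_gen_mem mE) /GRing.scale /= mulr1.
Qed.

Definition toc V : {linear V -> completion m V} := @to_completion R m V.

Lemma completion_to_completion_inj V : injective (cmap (toc V)).
Proof.
apply: linear_inj => y y0; apply: completion_ext => k.
rewrite -completion_repK; apply/mpi_eq0.
have /completion_proj_adic : toc V (completion_rep y k) \in adic_sub m (completion m V) k.
  by apply/mpi_eq0; rewrite -completion_mapE y0.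
by move/mpi_eq0.
Qed.

Lemma completion_to_completion_surj V z : exists y, cmap (toc V) y = z.
Proof. by apply: completion_map_surj => y; exact: to_completion_dense. Qed.

(** The two natural maps from the completion to its own completion agree, so the completion is
    m-adically complete. If [y'] is a preimage of [toc y], then modulo m^k of the completion [y] is
    the image of the k-th representative of [y']; projecting to V/m^k V gives y = y'. *)
Lemma to_completion_completion V : toc (completion m V) =1 cmap (toc V).
Proof.
move=> y; have [y' y'E] := completion_to_completion_surj (toc _ y).
suff yy' : y = y' by rewrite -y'E -yy'.
apply: completion_ext => k; have /(congr1 (@completion_proj _ k)) := y'E.
move/mpiP => /completion_proj_adic; rewrite linearB => /eqP.
rewrite subr_eq0 => /eqP/esym eqk; exact: etrans eqk (completion_repK y' k).
Qed.

(** On [completion m F], [L0_eps] composed with [L0_eta] is bijective, so it suffices that [L0_eps]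
    is injective. Every class there comes from L_0 F by density, and on L_0 F the composite with
    [L0_eps] is a composite of injections. *)
Lemma completion_L_complete F : lifting F -> L_complete m (completion m F).
Proof.
move=> liftF; have epsE (q : L0 m F) :
    L0_eps (L0_map m (toc F) q) = cmap (toc F) (L0_eps q) by exact: L0_eps_map.
have epsI q : @L0_eps R m (completion m F) q = 0 -> q = 0.
  have [p <-] := L0_map_surj (@to_completion_dense F) q.
  move=> /(etrans (esym (epsE p))) p0.
  have /(L0_eps_inj liftF) -> : L0_eps p = L0_eps 0; last exact: linear0.
  by apply: (@completion_to_completion_inj F); rewrite p0 !linear0.
have etaE (y : completion m F) : L0_eps (L0_eta m y) = cmap (toc F) y.
  exact: etrans (L0_eps_eta m y) (to_completion_completion y).
apply: inj_surj_bij => [|q].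
  move=> y z yz; apply: (@completion_to_completion_inj F).
  by rewrite -!etaE yz.
have [y yE] := completion_to_completion_surj (L0_eps q).
exists y; apply/eqP; rewrite -subr_eq0; apply/eqP/epsI.
by rewrite linearB /= etaE yE subrr.
Qed.

(** The difference of the maps vanishes on [V], and L_0 V maps onto L_0 of the completion; so L_0 of
    the difference is 0, hence so is the difference, its target being L-complete. *)
Lemma completion_maps_eq V B (u w : {linear completion m V -> B}) :
  L_complete m B -> (forall v, u (to_completion m v) = w (to_completion m v)) ->
  u =1 w.
Proof.
move=> [e etaK _] uw y; apply: (can_inj etaK).
apply/eqP; rewrite -subr_eq0 -linearB; apply/eqP.
pose f : {linear completion m V -> B} := u \- w.
apply: (etrans (esym (L0_map_eta m f y))).
have [q <-] := L0_map_surj (@to_completion_dense V) (L0_eta m y).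
rewrite -L0_map_comp; apply: L0_map_zero => v /=.
by rewrite -[LHS]/(u _ - w _) uw subrr.
Qed.

Lemma pro_free_projective M : pro_free m M -> Lc_projective m M.
Proof.
move=> [F /free_module_lifting liftF [phi /bijective_linear_inv[psi phiK psiK]]].
move=> A B Ac Bc f g /(Lc_epi_surj Ac Bc) fsurj.
have [eps' epsK eps'K] := bijective_linear_inv (L0_eps_bij m liftF).
have [eA eAK eA'K] := bijective_linear_inv Ac.
have [|t tE] := liftF _ _ f (g \o psi \o @L0_eta R m F).
  by move=> v; exact: fsurj.
(* The lift [t] on [F] extends to L_0 F because L_0 A is [A]; that it lifts [g] need only be checked
   on [F]. *)
exists (eA \o L0_map m t \o phi) => v /=.
have fgE : f \o eA \o L0_map m t \o eps' =1 g \o psi \o eps'.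
  apply: (@completion_maps_eq F B
    (f \o eA \o L0_map m t \o eps') (g \o psi \o eps')) => // y /=.
  by rewrite -L0_eps_eta epsK L0_map_eta eAK tE.
by have /= := fgE (L0_eps (phi v)); rewrite epsK phiK.
Qed.

Lemma projective_retract M : L_complete m M -> Lc_projective m M ->
  exists (K : choiceType) (i : {linear M -> completion m {freeg K / R}})
    (r : {linear completion m {freeg K / R} -> M}), forall v, r (i v) = v.
Proof.
move=> Mc Mp; have [eM eMK eM'K] := bijective_linear_inv Mc.
pose r : {linear completion m (res0 M) -> M} := eM \o mpi (mim (cmap (res_d M))).
have [| |i iE] := Mp (completion m (res0 M)) M _ Mc r idfun; last by exists M, i, r.
  exact/completion_L_complete/freeg_lifting.
move=> C _ g h gh v; have := gh (mrepr (L0_eta m v)).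
by rewrite /= mreprK eMK.
Qed.

End CompletionOfModule.

(** * The equational criterion for flatness *)

Section TensorProduct.
Variables (R : comNzRingType) (A M : lmodType R).

Lemma tensor_rel_eq (u v : {freeg (A * M)%type / R}) :
  bilin_rel A M (u - v) ->
  mpi (mspan (bilin_rel A M)) u = mpi (mspan (bilin_rel A M)) v.
Proof. by move=> uv; apply/mpiP/mem_mspan. Qed.

Lemma tensDl a b x : tens (a + b) x = tens a x + tens b x :> tensor A M.
Proof.
rewrite /tens -linearD; apply: tensor_rel_eq; constructor 1.
by exists a, b, x; rewrite opprD addrA.
Qed.

Lemma tensDr a x y : tens a (x + y) = tens a x + tens a y :> tensor A M.
Proof.
rewrite /tens -linearD; apply: tensor_rel_eq; constructor 2.
by exists a, x, y; rewrite opprD addrA.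
Qed.

Lemma tensZl r a x : tens (r *: a) x = r *: tens a x :> tensor A M.
Proof.
by rewrite /tens -linearZ; apply: tensor_rel_eq; constructor 3; exists r, a, x.
Qed.

Lemma tensZr r a x : tens a (r *: x) = r *: tens a x :> tensor A M.
Proof.
by rewrite /tens -linearZ; apply: tensor_rel_eq; constructor 4; exists r, a, x.
Qed.

Lemma tens0l x : tens 0 x = 0 :> tensor A M.
Proof. by rewrite -(scale0r 0) tensZl scale0r. Qed.

Lemma tens0r a : tens a 0 = 0 :> tensor A M.
Proof. by rewrite -(scale0r 0) tensZr scale0r. Qed.

Lemma tens_suml (I : Type) (r : seq I) (a : I -> A) x :
  tens (\sum_(i <- r) a i) x = \sum_(i <- r) tens (a i) x :> tensor A M.
Proof.
by elim: r => [|i r IH]; rewrite ?big_nil ?tens0l // !big_cons tensDl IH.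
Qed.

Lemma tens_sumr (I : Type) (r : seq I) a (x : I -> M) :
  tens a (\sum_(i <- r) x i) = \sum_(i <- r) tens a (x i) :> tensor A M.
Proof.
by elim: r => [|i r IH]; rewrite ?big_nil ?tens0r // !big_cons tensDr IH.
Qed.

Lemma tensor_sum (z : tensor A M) : exists n (a : 'I_n -> A) (x : 'I_n -> M),
  z = \sum_i tens (a i) (x i).
Proof.
rewrite -[z]mreprK; move: (mrepr z) => u; rewrite [u]freeg_gen_sum.
exists (size (dom u)), (fun i => coeff (tnth (in_tuple (dom u)) i) u *:
  (tnth (in_tuple (dom u)) i).1), (fun i => (tnth (in_tuple (dom u)) i).2).
rewrite linear_sum big_tnth; apply: eq_bigr => i _.
by rewrite linearZ tensZl /tens /= -surjective_pairing.
Qed.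

(** The universal property of the tensor product, in the only form used: a bilinear map respects
    vanishing sums. *)
Lemma tensor_lift (C : lmodType R) (b : A -> M -> C) :
  (forall x, linear (b^~ x)) -> (forall a, linear (b a)) ->
  forall (I : Type) (r : seq I) (a : I -> A) (x : I -> M),
    \sum_(i <- r) tens (a i) (x i) = 0 :> tensor A M ->
    \sum_(i <- r) b (a i) (x i) = 0.
Proof.
move=> bl br I r a x; rewrite /tens -linear_sum => /mpi_eq0 sum0.
pose g : {linear {freeg (A * M)%type / R} -> C} := fglift (fun p => b p.1 p.2).
have gE a' x' : g (fggen R (a', x')) = b a' x' by exact: fglift_gen.
transitivity (g (\sum_(i <- r) fggen R (a i, x i))).
  by rewrite linear_sum; apply: eq_bigr => i _; rewrite gE.
apply: (mspan_ind (P := fun z => g z = 0) _ _ _ _ sum0).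
- exact: linear0.
- by move=> u v u0 v0; rewrite linearD u0 v0 addr0.
- by move=> c u u0; rewrite linearZ /= u0 scaler0.
- move=> _ [] [c [s [t ->]]]; rewrite ?linearB ?linearZ /= !gE ?scalerN.
  + have := bl t 1 c s; rewrite !scale1r => ->.
    by rewrite addrAC addrK subrr.
  + have := br c 1 s t; rewrite !scale1r => ->.
    by rewrite addrAC addrK subrr.
  + have b0 : b 0 t = 0.
      by have := bl t 1 0 0; rewrite !scale1r addr0 -[LHS]addr0 => /addrI <-.
    by have := bl t c s 0; rewrite b0 !addr0 => ->; rewrite subrr.
  + have b0 : b s 0 = 0.
      by have := br s 1 0 0; rewrite !scale1r addr0 -[LHS]addr0 => /addrI <-.
    by have := br s c t 0; rewrite b0 !addr0 => ->; rewrite subrr.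
Qed.

End TensorProduct.

Section TensorMapLinear.
Variables (R : comNzRingType) (A B M : lmodType R) (f : {linear A -> B}).

Lemma tensor_map_linear : linear (@tensor_map R A B M f).
Proof.
pose g : {linear {freeg (A * M)%type / R} -> {freeg (B * M)%type / R}} :=
  fglift (fun p => fggen R (f p.1, p.2)).
pose q : {linear {freeg (A * M)%type / R} -> tensor B M} :=
  mpi (mspan (bilin_rel B M)) \o g.
have qE a x : q (fggen R (a, x)) = tens (f a) x.
  have gE : g (fggen R (a, x)) = fggen R (f a, x) by exact: fglift_gen.
  by rewrite /q /= gE.
apply: (quotmap_linear (f := g)) => z zA.
apply/mpi_eq0/(mspan_ind (P := fun z => q z = 0) _ _ _ _ zA).
- exact: linear0.
- by move=> u v u0 v0; rewrite linearD u0 v0 addr0.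
- by move=> r u u0; rewrite linearZZ u0 scaler0.
move=> _ [] [r [s [t ->]]]; rewrite ?linearB ?linearZZ !qE ?linearD ?linearZZ.
- by rewrite tensDl addrAC addrK subrr.
- by rewrite tensDr addrAC addrK subrr.
- by rewrite tensZl /= scalerN subrr.
- by rewrite tensZr /= scalerN subrr.
Qed.

End TensorMapLinear.

Section EquationalCriterion.
Variable R : comNzRingType.

(** The set [J] of relations may be infinite: [equational_flat] takes one relation for each element
    of [B]. *)
Definition equational (M : lmodType R) : Prop :=
  forall (I : finType) (J : Type) (c : J -> I -> R) (x : I -> M),
    (forall j, \sum_i c j i *: x i = 0) ->
    exists (K : finType) (b : I -> K -> R) (y : K -> M),
      (forall i, x i = \sum_l b i l *: y l) /\
      (forall j l, \sum_i c j i * b i l = 0).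

Lemma equational_retract (M N : lmodType R) (s : {linear M -> N})
    (t : {linear N -> M}) : cancel s t -> equational N -> equational M.
Proof.
move=> sK eN I J c x cx.
have [j|r [b [y [xE cb]]]] := eN I J c (s \o x).
  transitivity (s (\sum_i c j i *: x i)); last by rewrite cx linear0.
  by rewrite linear_sum; apply: eq_bigr => i _; rewrite linearZZ.
exists r, b, (t \o y); split=> // i.
rewrite -[x i]sK [X in t X]xE linear_sum.
by apply: eq_bigr => l _; rewrite linearZZ.
Qed.

(* Reading off the coefficient of the first component at each b : B presents a
   vanishing tensor through relations n_j among the elements of B. *)
Lemma tensor_vanish (B M : lmodType R) z : z \in mspan (bilin_rel B M) ->
  exists (K : finType) (n : K -> res0 B) (y : K -> M),
    (forall j, res_aug B (n j) = 0) /\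
    forall b, fglift (fun p : B * M => if p.1 == b then p.2 else 0) z
      = \sum_j coeff b (n j) *: y j.
Proof.
pose phi b : {linear {freeg (B * M)%type / R} -> M} :=
  fglift (fun p : B * M => if p.1 == b then p.2 else 0).
have phiE b a x : phi b (fggen R (a, x)) = if a == b then x else 0.
  exact: fglift_gen.
have coeffE b a : coeff b (fggen R a) = (a == b)%:R :> R.
  by rewrite coeffU mul1r.
pose P z := exists (K : finType) (n : K -> res0 B) (y : K -> M),
    (forall j, res_aug B (n j) = 0) /\
    forall b, phi b z = \sum_j coeff b (n j) *: y j.
apply: (mspan_ind (P := P)) => [|u v|a u|u] //.
- exists 'I_0, (fun=> 0), (fun=> 0); split=> [j|b]; first exact: linear0.
  by rewrite linear0 big_ord0.
- move=> [K [n [y [n0 uE]]]] [K' [n' [y' [n'0 vE]]]].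
  exists (K + K')%type, (fun j => match j with inl j => n j | inr j => n' j end).
  exists (fun j => match j with inl j => y j | inr j => y' j end).
  by split=> [[]//|b]; rewrite linearD uE vE big_sumType.
- move=> [K [n [y [n0 uE]]]]; exists K, n, (fun j => a *: y j); split=> // b.
  rewrite linearZ /= uE scaler_sumr; apply: eq_bigr => j _.
  by rewrite !scalerA mulrC.
- have one (n : res0 B) (y : M) : res_aug B n = 0 ->
      (forall b, phi b u = coeff b n *: y) -> P u.
    move=> n0 uE; exists 'I_1, (fun=> n), (fun=> y); split=> // b.
    by rewrite big_ord1 uE.
  case=> -[r [s [t uE]]].
  + apply: (one (fggen R (r + s) - fggen R r - fggen R s) t).
      by rewrite !linearB /= !res_aug_gen addrAC addrK subrr.
    move=> b; rewrite uE !linearB /= !phiE !coeffB !coeffE !scalerBl.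
    by do 3![case: (_ == b)]; rewrite ?scale1r ?scale0r.
  + apply: (one 0 0) => [|b]; first exact: linear0.
    rewrite uE !linearB /= !phiE scaler0.
    by case: (_ == b); rewrite ?addrK ?subrr // addrAC addrK subrr.
  + apply: (one (fggen R (r *: s) - r *: fggen R s) t).
      by rewrite linearB linearZ /= !res_aug_gen subrr.
    move=> b; rewrite uE linearB linearZ /= !phiE coeffB coeffZ !coeffE.
    rewrite scalerBl -scalerA.
    by do 2![case: (_ == b)]; rewrite ?scale1r ?scale0r ?scaler0.
  + apply: (one 0 0) => [|b]; first exact: linear0.
    rewrite uE linearB linearZ /= !phiE scaler0.
    by case: (_ == b); rewrite ?scaler0 subrr.
Qed.

Lemma equational_flat (M : lmodType R) : equational M -> flat M.
Proof.
move=> eM A B f fI.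
suff : injective (mklin (@tensor_map_linear R A B M f)) by [].
apply: linear_inj => z; have [n [a [x ->]]] := tensor_sum z.
rewrite linear_sum; under eq_bigr do rewrite mklinE tensor_mapE.
rewrite /tens -linear_sum => /mpi_eq0/tensor_vanish[K [N [y [N0 sumE]]]].
(* The relation at [b] equates the sum of the x_i with f (a_i) = b to the coefficient of b in the
   presentation by [N] and [y]. *)
pose c b (i : 'I_n + K) : R :=
  match i with inl i => (f (a i) == b)%:R | inr j => - coeff b (N j) end.
pose v i := match i with inl i => x i | inr j => y j end.
have [b|r [u [w [vE cu]]]] := eM _ B c v.
  rewrite big_sumType /=; under [X in _ + X]eq_bigr do rewrite scaleNr.
  rewrite sumrN -sumE linear_sum; apply/eqP; rewrite subr_eq0; apply/eqP.
  apply: eq_bigr => i _ /=; rewrite fglift_gen /=.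
  by case: eqP; rewrite ?scale1r ?scale0r.
have a0 l : \sum_i u (inl i) l *: a i = 0.
  apply: fI; rewrite linear0 linear_sum.
  (* The solved relations say that every coefficient of the formal sum [t] is 0. Its augmentation is
     the image under [f] of the desired sum, the [N j] having augmentation 0. *)
  pose t : res0 B := \sum_i u (inl i) l *: fggen R (f (a i)) -
     \sum_j u (inr j) l *: N j.
  have t0 : t = 0.
    apply/eqP/freeg_eqP => b; rewrite coeff0 -(cu b l) big_sumType /= coeffB.
    rewrite !(raddf_sum (coeff b)) -sumrN.
    congr (_ + _); apply: eq_bigr => i _; rewrite /= coeffZ mulrC ?mulNr //.
    by rewrite coeffU mul1r.
  have := congr1 (res_aug B) t0; rewrite linear0 linearB !(linear_sum (res_aug B)).
  rewrite [X in _ - X]big1 ?subr0 => [u0|j _]; last by rewrite linearZZ N0 scaler0.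
  by rewrite -[RHS]u0; apply: eq_bigr => i _; rewrite !linearZZ res_aug_gen.
transitivity (\sum_l tens (\sum_i u (inl i) l *: a i) (w l) : tensor A M); last first.
  by rewrite big1 // => l _; rewrite a0 tens0l.
under [RHS]eq_bigr do rewrite tens_suml.
rewrite exchange_big; apply: eq_bigr => i _ /=.
rewrite -/(tens _ _) [x i](vE (inl i)) tens_sumr.
by apply: eq_bigr => l _; rewrite tensZl tensZr.
Qed.

End EquationalCriterion.

(** * Inverses modulo m and finite generation over a Noetherian ring *)

(** Otherwise m + R u would be a proper ideal containing m, hence m itself. *)
Lemma local_unit (R : comNzRingType) (m : idealr R) u :
  maximal_ideal m -> u \notin m -> exists v, v * u - 1 \in m.
Proof.
move=> mmax um; apply: contrapT => nv.
pose J : pred R := fun r => `[< exists a v, a \in m /\ r = a + v * u >].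
have JE r : reflect (exists a v, a \in m /\ r = a + v * u) (r \in J) by exact: asboolP.
have Jid : idealr_closed J.
  split; first by apply/JE; exists 0, 0; rewrite rpred0 mul0r addr0.
    apply/JE => -[a [v [am E]]]; apply: nv; exists v.
    by rewrite E opprD addrC addrNK rpredN.
  move=> a x y /JE[b [v [bm ->]]] /JE[c [w [cm ->]]].
  apply/JE; exists (a * b + c), (a * v + w); split.
    by rewrite rpredD // idealMr.
  by rewrite mulrDr addrACA mulrDl mulrA.
pose JI : idealr R := HB.pack J (isIdealr.Build R J Jid).
have /(_ u) : JI =i m.
  by apply: mmax => a am; apply/JE; exists a, 0; rewrite mul0r addr0.
rewrite (negPf um) => /negP[]; apply/JE.
by exists 0, 1; rewrite rpred0 mul1r add0r.
Qed.

Section FinitelyGenerated.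
Variable R : comNzRingType.

Definition fin_gen (V : lmodType R) (S : submodClosed V) : Prop :=
  exists (K : finType) (b : K -> V), (forall k, b k \in S) /\
    forall v, v \in S -> exists c : K -> R, v = \sum_k c k *: b k.

Hypothesis noethR : noetherian R.

Lemma noetherian_fin_gen (I : submodClosed R^o) : fin_gen I.
Proof.
have [s sE] := noethR I; exists 'I_(size s), (fun i : 'I_(size s) => s`_i); split=> [i|v].
  by rewrite sE; apply: mem_mspan; exact: mem_nth.
rewrite sE => vs; apply: mspan_rangeP.
apply: mspan_sub vs => y ys; apply: mem_mspan.
have ys' : (index y s < size s)%N by rewrite index_mem.
by exists (Ordinal ys') => //=; rewrite nth_index.
Qed.

(** Induction on n: generators of the ideal of first coordinates are lifted to S, and the vectors of
    S with first coordinate 0 form a submodule of R^(n-1). *)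
Lemma noetherian_rV n (S : submodClosed 'rV[R]_n) : fin_gen S.
Proof.
elim: n S => [|n IH] S.
  exists 'I_0, (fun=> 0); split=> [[]//|v _]; exists (fun=> 0).
  by apply/rowP => -[].
pose P (a : R^o) := exists2 v, v \in S & v 0 0 = a.
have P0 : P 0 by exists 0; [exact: rpred0 | rewrite mxE].
have PD a b : P a -> P b -> P (a + b).
  by move=> [v vS <-] [w wS <-]; exists (v + w); [exact: rpredD | rewrite mxE].
have PZ r a : P a -> P (r *: a).
  by move=> [v vS <-]; exists (r *: v); [exact: rpredZ | rewrite mxE].
have [K [a [aP aspan]]] := noetherian_fin_gen (mksub P0 PD PZ).
have /choice[s sP] k : exists v, v \in S /\ v 0 0 = a k.
  by have /mksubP[v vS va] := aP k; exists v.
pose iota (w : 'rV[R]_n) : 'rV[R]_n.+1 := \row_j oapp (w 0) 0 (unlift ord0 j).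
have iL : linear iota.
  move=> r v w; apply/rowP => j; rewrite !mxE.
  by case: unliftP => [i _|_] /=; rewrite ?mxE ?mulr0 ?addr0.
have [K' [b [bP bspan]]] := IH (mpreim (mklin iL) S).
exists (K + K')%type, (fun k => match k with inl k => s k
  | inr k => mklin iL (b k) end); split=> [[k|k]|v vS].
- by case: (sP k).
- exact: bP.
have [|c cE] := aspan (v 0 0); first by apply/mksubP; exists v.
pose v' := v - \sum_k c k *: s k.
have v'0 : v' 0 0 = 0.
  rewrite !mxE cE summxE -sumrB big1 // => k _.
  by rewrite mxE (sP k).2 subrr.
pose w' : 'rV[R]_n := \row_(j < n) v' 0 (fintype.lift ord0 j).
have v'E : v' = mklin iL w'.
  apply/rowP => j; rewrite mklinE [RHS]mxE.
  by case: unliftP => [i ->|->] /=; rewrite ?v'0 // [RHS]mxE.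
have [|e eE] := bspan w'.
  rewrite mem_mpreim -v'E /v' submodB // rpred_sum // => k _.
  by rewrite rpredZ // (sP k).1.
exists (fun k => match k with inl k => c k | inr k => e k end).
rewrite big_sumType /= -[LHS](subrK (\sum_k c k *: s k)) addrC -/v' v'E eE.
by rewrite linear_sum; congr (_ + _); apply: eq_bigr => k _; rewrite linearZZ.
Qed.

End FinitelyGenerated.

(** * Chevalley's theorem *)

Section DescendingChain.
Variables (R : comNzRingType) (m : idealr R) (V : lmodType R).
Hypothesis mmax : maximal_ideal m.
Variable W : nat -> submodClosed V.
Hypothesis Wle : forall i j, (i <= j)%N -> {subset W j <= W i}.

(** For S inside T: the chain induced by [W] on T/S is stationary from [c0] on, written without the
    quotient. *)
Definition chain_stable (S T : {pred V}) : Prop :=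
  exists c0, forall c, (c0 <= c)%N -> forall w, w \in W c0 -> w \in T ->
    exists2 w', w' \in W c & w - w' \in S.

Lemma chain_stable_trans (S T U : {pred V}) :
  chain_stable S T -> chain_stable T U -> chain_stable S U.
Proof.
move=> [c1 H1] [c0 H0]; exists (maxn c0 c1) => c; rewrite geq_max.
move=> /andP[le0 le1] w wW wU.
have [|w' w'W w'T] := H0 c le0 w _ wU; first exact: Wle (leq_maxl _ _) _ wW.
have [|w'' w''W w''S] := H1 c le1 (w - w') _ w'T.
  apply: submodB; [exact: Wle (leq_maxr _ _) _ wW | exact: Wle le1 _ w'W].
by exists (w' + w''); rewrite ?rpredD // opprD addrA.
Qed.

(* T/S is spanned by e and killed by m, so it is 0 or a simple module. *)
Lemma chain_stable_simple (S : submodClosed V) (T : {pred V}) e :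
  (forall a, a \in m -> a *: e \in S) ->
  (forall v, v \in T -> exists a y, y \in S /\ v = y + a *: e) ->
  chain_stable S T.
Proof.
move=> meS TP.
(* Either some [W c] meets T inside S, and w' = 0 serves from there on; or each [W c] has an element
   of T outside S, whose multiples fill T modulo S since its coefficient at [e] is invertible modulo
   m. *)
have [[c cS]|nS] := pselect (exists c, forall w, w \in W c -> w \in T -> w \in S).
  exists c => c' cc' w wW wT; exists 0; first exact: rpred0.
  by rewrite subr0 cS.
exists 0%N => c _ w _ wT; have [a [y [yS wE]]] := TP _ wT.
have [z [zW zT zS]] : exists z, [/\ z \in W c, z \in T & z \notin S].
  apply: contrapT => nz; apply: nS; exists c => z zW zT.
  by apply: contrapT => /negP zS; apply: nz; exists z.
have [u [x [xS zE]]] := TP _ zT.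
have um : u \notin m by apply: contra zS => um; rewrite zE rpredD // meS.
have [v vu] := local_unit mmax um.
exists ((a * v) *: z); first by rewrite rpredZ.
have -> : w - (a * v) *: z = y - (a * v) *: x - (a * (v * u - 1)) *: e.
  rewrite mulrBr mulr1 scalerBl opprB mulrA.
  by rewrite wE zE scalerDr scalerA opprD addrACA.
by apply: submodB; [apply: submodB; rewrite ?rpredZ | rewrite meS ?idealMr].
Qed.

(** Adding the generators of T to S one at a time gives a finite filtration with steps as in
    [chain_stable_simple]. *)
Lemma chain_stable_fin_gen (S T : submodClosed V) :
  fin_gen T -> (forall a v, a \in m -> v \in T -> a *: v \in S) ->
  chain_stable S T.
Proof.
move=> [K [b [bT Tspan]]] mTS.
pose P (r : seq K) v := exists (c : K -> R) y, y \in S /\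
  v = y + \sum_(k <- r) c k *: b k.
have P0 r : P r 0.
  by exists (fun=> 0), 0; rewrite rpred0 big1 ?addr0 // => k _; rewrite scale0r.
have PD r v w : P r v -> P r w -> P r (v + w).
  move=> [c [y [yS ->]]] [d [z [zS ->]]]; exists (fun k => c k + d k), (y + z).
  rewrite rpredD //; split=> //; rewrite addrACA -big_split; congr (_ + _).
  by apply: eq_bigr => k _; rewrite scalerDl.
have PZ r a v : P r v -> P r (a *: v).
  move=> [c [y [yS ->]]]; exists (fun k => a * c k), (a *: y).
  rewrite rpredZ //; split=> //; rewrite scalerDr scaler_sumr; congr (_ + _).
  by apply: eq_bigr => k _; rewrite scalerA.
pose Y r := mksub (P0 r) (PD r) (PZ r).
have SY r : chain_stable S (Y r).
  elim: r => [|k r IH].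
    exists 0%N => c _ w _ /mksubP[d [y [yS ->]]]; exists 0; first exact: rpred0.
    by rewrite big_nil addr0 subr0.
  apply: chain_stable_trans IH _.
  apply: (@chain_stable_simple (Y r) _ (b k)) => [a am|v /mksubP[c [y [yS ->]]]].
    apply/mksubP; exists (fun=> 0), (a *: b k); rewrite mTS //; split=> //.
    by rewrite big1 ?addr0 // => i _; rewrite scale0r.
  exists (c k), (y + \sum_(i <- r) c i *: b i); split.
    by apply/mksubP; exists c, y.
  by rewrite big_cons addrCA addrC -addrA [X in _ + X]addrC.
have [c0 H] := SY (index_enum K); exists c0 => c cc w wW wT.
apply: H => //; apply/mksubP; have [d ->] := Tspan w wT.
by exists d, 0; rewrite rpred0 add0r.
Qed.

End DescendingChain.

Section Chevalley.
Variables (R : comNzRingType) (m : idealr R).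
Hypotheses (noethR : noetherian R) (mmax : maximal_ideal m).
Hypothesis Rcomplete : adic_complete m.

Lemma adic_separated (a : R) : (forall k, a \in ideal_pow m k) -> a = 0.
Proof.
move=> am; have [g gK _] := Rcomplete.
apply: (can_inj (f := @to_completion R m R^o) gK).
rewrite [RHS]linear0; apply/to_completion_eq0 => k.
by rewrite adic_sub_regular; exact: am.
Qed.

Lemma adic_limit (s : nat -> R) :
  (forall k, s k.+1 - s k \in ideal_pow m k) ->
  exists y, forall k, y - s k \in ideal_pow m k.
Proof.
move=> sS; have [g _ gK] := Rcomplete.
have sS' k : (s : nat -> R^o) k.+1 - (s : nat -> R^o) k \in adic_sub m R^o k.
  by rewrite adic_sub_regular.
exists (g (completion_of_seq sS')) => k; rewrite -adic_sub_regular.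
by apply/mpiP; have /(congr1 (fun x => completion_seq x k)) := gK (completion_of_seq sS').
Qed.

Section Submodule.
Variables (n : nat) (Z : submodClosed 'rV[R]_n).
Variables (K : finType) (b : K -> 'rV[R]_n).
Hypothesis Zspan :
  forall v, v \in Z -> exists c : K -> R, v = \sum_k c k *: b k.

Definition adic_trace_pred c (w : 'rV[R]_n) :=
  w \in Z /\ forall i, w 0 i \in ideal_pow m c.

Fact adic_trace0 c : adic_trace_pred c 0.
Proof. by split=> [|i]; rewrite ?rpred0 // mxE ideal_pow0. Qed.

Fact adic_traceD c v w :
  adic_trace_pred c v -> adic_trace_pred c w -> adic_trace_pred c (v + w).
Proof.
move=> [vZ vc] [wZ wc]; split=> [|i]; first exact: rpredD.
by rewrite mxE ideal_powD.
Qed.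

Fact adic_traceZ c a v : adic_trace_pred c v -> adic_trace_pred c (a *: v).
Proof.
by move=> [vZ vc]; split=> [|i]; [exact: rpredZ | rewrite mxE ideal_powZ].
Qed.

(** The intersection of Z with m^c R^n. *)
Definition adic_trace c : submodClosed 'rV[R]_n :=
  mksub (adic_trace0 c) (@adic_traceD c) (@adic_traceZ c).

Lemma adic_trace_le i j : (i <= j)%N -> {subset adic_trace j <= adic_trace i}.
Proof.
move=> ij w /mksubP[wZ wj]; apply/mksubP; split=> // l.
exact: ideal_pow_le ij _ (wj l).
Qed.

Definition adic_span_pred j (w : 'rV[R]_n) :=
  exists y : K -> R, (forall k, y k \in ideal_pow m j) /\ w = \sum_k y k *: b k.

Fact adic_span0 j : adic_span_pred j 0.
Proof.
exists (fun=> 0); split=> [k|]; first exact: ideal_pow0.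
by rewrite big1 // => k _; rewrite scale0r.
Qed.

Fact adic_spanD j v w :
  adic_span_pred j v -> adic_span_pred j w -> adic_span_pred j (v + w).
Proof.
move=> [y [yj ->]] [z [zj ->]]; exists (fun k => y k + z k); split=> [k|].
  exact: ideal_powD.
by rewrite -big_split; apply: eq_bigr => k _; rewrite scalerDl.
Qed.

Fact adic_spanZ j a v : adic_span_pred j v -> adic_span_pred j (a *: v).
Proof.
move=> [y [yj ->]]; exists (fun k => a * y k); split=> [k|].
  exact: ideal_powZ.
by rewrite scaler_sumr; apply: eq_bigr => k _; rewrite scalerA.
Qed.

(** This is m^j Z when the [b k] lie in Z. *)
Definition adic_span j : submodClosed 'rV[R]_n :=
  mksub (adic_span0 j) (@adic_spanD j) (@adic_spanZ j).

Lemma adic_trace_stable j : chain_stable adic_trace (adic_span j) Z.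
Proof.
elim: j => [|j IH].
  exists 0%N => c _ w _ /Zspan[y ->]; exists 0; first exact: rpred0.
  by rewrite subr0; apply/mksubP; exists y.
apply: (chain_stable_trans adic_trace_le _ IH).
apply: (chain_stable_fin_gen mmax).
- exact: adic_trace_le.
- exact: noetherian_rV.
move=> a v am /mksubP[y [yj ->]]; rewrite scaler_sumr; apply/mksubP.
exists (fun k => a * y k); split=> [k|].
  by apply: mem_mspan; exists a, (y k).
by apply: eq_bigr => k _; rewrite scalerA.
Qed.

(* Chevalley's theorem for Z: the topology induced on Z by R^n is its m-adic
   topology. *)
Lemma adic_trace_span : exists2 c : nat -> nat, {homo c : i j / (i <= j)%N} &
  (forall j, (j <= c j)%N) /\
  forall j, {subset adic_trace (c j) <= adic_span j}.
Proof.
have /choice[c0 c0P] := adic_trace_stable.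
(* Adding j and all earlier bounds makes [c] monotone and at least j. *)
pose c j := (j + \sum_(i < j.+1) c0 i)%N.
have cP j : forall c', (c j <= c')%N -> forall w, w \in adic_trace (c j) ->
    exists2 w', w' \in adic_trace c' & w - w' \in adic_span j.
  move=> c' cc' w wc; have le0 : (c0 j <= c j)%N.
    by rewrite /c big_ord_recr addnA leq_addl.
  apply: c0P; [exact: leq_trans le0 cc' | exact: adic_trace_le le0 _ wc |].
  by have /mksubP[] := wc.
have cle : {homo c : i j / (i <= j)%N}.
  apply: homo_leq => [//|? ? ?|i]; first exact: leq_trans.
  by rewrite leq_add // [X in (_ <= X)%N]big_ord_recr leq_addr.
exists c => //; split=> [j|j w wc]; first exact: leq_addr.
(* Starting from [w], the terms s_i lie in the trace of level c (j + i) and s_i - s_(i+1) has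
   coefficients in m^(j+i). These coefficients are summed in R by completeness, while s_i tends to
   0. *)
have [|i v vc|s [s0 s1 s2]] := @dependent_choice_seq _
    (fun i w => w \in adic_trace (c (j + i)%N))
    (fun i w w' => w - w' \in adic_span (j + i)) w.
- by rewrite addn0.
- have [|v' v'c vv'] := cP _ (c (j + i.+1)%N) _ v vc; last by exists v'.
  by rewrite cle // addnS.
have /choice[y yP] i : exists y : K -> R, (forall k, y k \in ideal_pow m (j + i)) /\
    s i - s i.+1 = \sum_k y k *: b k by have /mksubP := s2 i.
have /choice[z zP] k : exists z, forall i, z - \sum_(l < i) y l k \in ideal_pow m i.
  apply: adic_limit => i; rewrite big_ord_recr /= addrAC subrr add0r.
  exact: ideal_pow_le (leq_addl _ _) _ ((yP i).1 k).
apply/mksubP; exists z; split=> [k|].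
  rewrite -(subrK (\sum_(l < j) y l k) (z k)) ideal_powD // ideal_pow_sum // => l _.
  exact: ideal_pow_le (leq_addr _ _) _ ((yP l).1 k).
have sE i : w - s i = \sum_k (\sum_(l < i) y l k) *: b k.
  elim: i => [|i IH].
    by rewrite s0 subrr big1 // => k _; rewrite big_ord0 scale0r.
  under eq_bigr do rewrite big_ord_recr scalerDl.
  by rewrite big_split /= -IH -(yP i).2 addrA subrK.
apply/rowP => l; apply/eqP; rewrite -subr_eq0; apply/eqP/adic_separated => i.
have wE : w - \sum_k z k *: b k =
    s i - \sum_k (z k - \sum_(l < i) y l k) *: b k.
  under [in RHS]eq_bigr do rewrite scalerBl.
  by rewrite sumrB -sE opprB addrA [X in _ = X - _]addrC subrK.
have -> : w 0 l - (\sum_k z k *: b k) 0 l =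
    s i 0 l - \sum_k (z k - \sum_(l < i) y l k) * b k 0 l.
  transitivity ((w - \sum_k z k *: b k) 0 l); first by rewrite !mxE.
  rewrite wE mxE; congr (_ + _); rewrite mxE summxE; congr (- _).
  by apply: eq_bigr => k _; rewrite mxE.
rewrite ideal_powB //.
  have /mksubP[_ /(_ l)] := s1 i; apply: ideal_pow_le.
  by rewrite (leq_trans (leq_addl j i)) // leq_addr.
by apply: ideal_pow_sum => k _; rewrite mulrC ideal_powZ.
Qed.

(** One choice of coefficients must serve all j at once: it is taken at the largest j with [w] in
    the trace of level c j. If there is no largest one, w = 0 by separatedness. *)
Lemma adic_lift : exists c : nat -> nat, forall w, w \in Z ->
  exists y : K -> R, w = \sum_k y k *: b k /\
    forall j, (forall i, w 0 i \in ideal_pow m (c j)) ->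
      forall k, y k \in ideal_pow m j.
Proof.
have [c cle [lec cP]] := adic_trace_span; exists c => w wZ.
have trace j : (forall i, w 0 i \in ideal_pow m (c j)) -> w \in adic_trace (c j).
  by move=> wj; apply/mksubP.
have [all|] := pselect (forall j, w \in adic_trace (c j)).
  exists (fun=> 0); split=> [|j _ k]; last exact: ideal_pow0.
  rewrite big1 => [|k _]; last by rewrite scale0r.
  apply/rowP => i; rewrite mxE; apply: adic_separated => j.
  by have /mksubP[_ /(_ i)] := all j; apply: ideal_pow_le.
move=> /existsNP[j0 /negP j0n].
have exn : exists j, w \notin adic_trace (c j) by exists j0.
case: (ex_minnP exn) => -[|j] jn jmin.
  (* Failure already at level c 0 makes every condition on [w] false, so any coefficients do. *)
  have [y yE] := Zspan wZ; exists y; split=> // i /trace wi.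
  by case/negP: jn; exact: adic_trace_le (cle _ _ (leq0n i)) _ wi.
have /cP/mksubP[y [yj wE]] : w \in adic_trace (c j).
  by apply: contraT => /jmin; rewrite ltnn.
exists y; split=> // i /trace wi k.
apply: ideal_pow_le (yj k); rewrite -ltnS ltnNge; apply/negP => ij.
by case/negP: jn; exact: adic_trace_le (cle _ _ ij) _ wi.
Qed.

End Submodule.
End Chevalley.

Lemma completion_seq_sum (R : comNzRingType) (m : {pred R}) (V : lmodType R)
    (I : finType) (a : I -> R) (x : I -> completion m V) k :
  completion_seq (\sum_i a i *: x i) k
    = mpi (adic_sub m V k) (\sum_i a i *: completion_rep (x i) k).
Proof.
rewrite -[LHS]/(completion_proj k _) !linear_sum; apply: eq_bigr => i _.
by rewrite !linearZZ; congr (_ *: _); apply/esym/completion_repK.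
Qed.

(** * Flatness of completed free modules *)

Section CompletedFree.
Variables (R : comNzRingType) (m : {pred R}) (K : choiceType).
Local Notation F := {freeg K / R}.

Lemma adic_sub_coeff (u : F) k :
  (u \in adic_sub m F k) <-> (forall i, coeff i u \in ideal_pow m k).
Proof.
split=> [uk i|uk].
  apply: (adic_sub_ind (P := fun u : F => coeff i u \in ideal_pow m k) _ _ _ uk).
  - by rewrite coeff0 ideal_pow0.
  - by move=> v w vk wk; rewrite coeffD ideal_powD.
  - by move=> a v ak; rewrite coeffZ mulrC ideal_powZ.
rewrite [u]freeg_gen_sum rpred_sum // => i _; exact/mem_adic_sub/uk.
Qed.

(** A family tending to 0 is an element of the completed free module: its partial sums over [D k]
    form a Cauchy sequence. The converse passage is [completion_coords]. *)
Lemma completion_of_coords (y : K -> R) (D : nat -> seq K) :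
  (forall k i, i \notin D k -> y i \in ideal_pow m k) ->
  exists x : completion m F,
    forall k i, y i - coeff i (completion_rep x k) \in ideal_pow m k.
Proof.
move=> yD; pose u k : F := \sum_(i <- undup (D k)) y i *: fggen R i.
have uE k i : coeff i (u k) = (i \in D k)%:R * y i.
  rewrite /u raddf_sum /=; under eq_bigr do rewrite coeffZ coeffU mul1r.
  have [iD|iD] := boolP (i \in D k); last first.
    rewrite mul0r big1_seq // => j; rewrite mem_undup => /andP[_ jD].
    by have /negPf -> : j != i; [apply: contraNneq iD => <- | rewrite mulr0].
  rewrite (bigD1_seq i) ?mem_undup ?undup_uniq //= eqxx mulr1 mul1r.
  by rewrite big1 ?addr0 // => j /negPf ->; rewrite mulr0.
have uy k i : y i - coeff i (u k) \in ideal_pow m k.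
  rewrite uE; have [iD|iD] := boolP (i \in D k).
    by rewrite mul1r subrr ideal_pow0.
  by rewrite mul0r subr0 yD.
have uS k : u k.+1 - u k \in adic_sub m F k.
  apply/adic_sub_coeff => i; rewrite coeffB.
  by rewrite -(subrBB (y i)) ideal_powB // ideal_powS.
exists (completion_of_seq uS) => k i.
have : completion_rep (completion_of_seq uS) k - u k \in adic_sub m F k.
  by apply/mpiP; rewrite completion_repK.
move/adic_sub_coeff => /(_ i); rewrite coeffB => ruk.
set r := coeff i (completion_rep _ k) in ruk *.
have -> : y i - r = y i - coeff i (u k) - (r - coeff i (u k)).
  by rewrite opprB addrA subrK.
exact: ideal_powB.
Qed.

End CompletedFree.

Section CompletedFreeFlat.
Variables (R : comNzRingType) (m : idealr R) (K : choiceType).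
Hypotheses (noethR : noetherian R) (mmax : maximal_ideal m).
Hypothesis Rcomplete : adic_complete m.
Local Notation F := {freeg K / R}.

Lemma completion_coords (x : completion m F) : exists v : K -> R,
  forall i k, v i - coeff i (completion_rep x k) \in ideal_pow m k.
Proof.
suff /choice[v vP] i : exists a : R,
    forall k, a - coeff i (completion_rep x k) \in ideal_pow m k by exists v.
apply: adic_limit => // k; rewrite -coeffB.
by have /adic_sub_coeff := completion_repS x k; exact.
Qed.

Lemma completed_free_equational : equational (completion m F).
Proof.
move=> I J c x cx.
have /choice[v vP] i := completion_coords (x i).
pose vec k : 'rV[R]_#|I| := \row_i v (enum_val i) k.
pose P (u : 'rV[R]_#|I|) := forall j, \sum_i c j i * u 0 (enum_rank i) = 0.
have P0 : P 0 by move=> j; rewrite big1 // => i _; rewrite mxE mulr0.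
have PD u w : P u -> P w -> P (u + w).
  move=> Pu Pw j; under eq_bigr do rewrite mxE mulrDr.
  by rewrite big_split /= Pu Pw addr0.
have PZ a u : P u -> P (a *: u).
  move=> Pu j; under eq_bigr do rewrite mxE mulrCA.
  by rewrite -mulr_sumr Pu mulr0.
pose Z := mksub P0 PD PZ.
(* The equations hold modulo every m^l, hence exactly since R is separated. *)
have vecZ k : vec k \in Z.
  apply/mksubP => j; apply: (adic_separated Rcomplete) => l.
  have cxl : \sum_i c j i *: completion_rep (x i) l \in adic_sub m F l.
    by apply/mpi_eq0; rewrite -completion_seq_sum cx.
  have /(_ k) := (adic_sub_coeff _ _ _).1 cxl.
  rewrite raddf_sum /=; set S := \sum_i _ => Sl; rewrite -[X in X \in _](subrK S).
  rewrite ideal_powD // -sumrB ideal_pow_sum // => i _.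
  by rewrite coeffZ mxE enum_rankK -mulrBr ideal_powZ.
have [L [b [bZ bspan]]] := noetherian_rV noethR Z.
have [d dP] := adic_lift noethR mmax Rcomplete bspan.
have /choice[y yP] k := dP _ (vecZ k).
(* Off the supports of the representatives of level d j, all coordinates lie in m^(d j), and
   [adic_lift] then puts the coefficients in m^j. *)
pose D j := flatten [seq dom (completion_rep (x i) (d j)) | i <- enum I].
have yD l j k : k \notin D j -> y k l \in ideal_pow m j.
  move=> kD; apply: (yP k).2 => i; rewrite mxE.
  have := vP (enum_val i) k (d j); rewrite coeff_outdom ?subr0 //.
  apply: contra kD => kd; apply/flattenP; eexists; last exact: kd.
  by apply: map_f; rewrite mem_enum.
have /choice[Y YP] l := completion_of_coords (yD l).
exists L, (fun i l => b l 0 (enum_rank i)), Y; split; last first.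
  by move=> j l; have /mksubP := bZ l; exact.
move=> i; apply: completion_ext => k.
rewrite completion_seq_sum -completion_repK.
apply/mpiP/adic_sub_coeff => t; rewrite coeffB raddf_sum.
have vE : v i t = \sum_l y t l * b l 0 (enum_rank i).
  have /rowP/(_ (enum_rank i)) := (yP t).1; rewrite mxE enum_rankK summxE => ->.
  by apply: eq_bigr => l _; rewrite mxE.
rewrite -(subrBB (v i t)) ideal_powB // vE -sumrB ideal_pow_sum // => l _.
by rewrite /= coeffZ mulrC -mulrBr ideal_powZ.
Qed.

End CompletedFreeFlat.

(** * Submodules as modules in their own right *)

Section SubmoduleType.
Variables (R : comNzRingType) (V : lmodType R) (S : submodClosed V).

Record submod_type : Type := SubmodType {
  submod_val : V; submod_valP : submod_val \in S }.

HB.instance Definition _ := [isSub for submod_val].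
HB.instance Definition _ := [Choice of submod_type by <:].
HB.instance Definition _ := [SubChoice_isSubLmodule of submod_type by <:].

Lemma submod_val_linear : linear submod_val.
Proof. by []. Qed.

HB.instance Definition _ :=
  GRing.isLinear.Build R submod_type V *:%R submod_val submod_val_linear.

End SubmoduleType.

(** * Flat modules and bases modulo m *)

Section ResidueBasis.
Variables (R : comNzRingType) (m : idealr R) (N : lmodType R).
Hypothesis mmax : maximal_ideal m.
Local Notation mN := (adic_sub m N 1).

Lemma ideal_pow1 a : (a \in ideal_pow m 1) = (a \in m).
Proof.
apply/idP/idP => [a1|am]; last first.
  by apply: mem_mspan; exists a, 1; rewrite /GRing.scale /= mulr1.
apply: (@mspan_ind R R^o (fun a : R => a \in m) _ _ _ _ _ _ a1).
- exact: idealr0.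
- by move=> x y; exact: rpredD.
- by move=> r x; exact: idealMr.
- by move=> _ [b [c [bm _ ->]]]; rewrite [_ *: _]mulrC; exact: idealMr.
Qed.

(** The elements of A have distinct images in N/mN, linearly independent over R/m. *)
Definition residue_free (A : set N) : Prop :=
  forall z : res0 N, (forall k, k \in dom z -> A k) -> res_aug N z \in mN ->
  forall k, coeff k z \in m.

(** A finite part of the union of a chain lies in one member; the empty list is set apart because
    the chain may be empty. *)
Lemma chain_seq (T : eqType) (F : set (set T)) (s : seq T) :
  total_on F subset -> (forall k, k \in s -> (\bigcup_(X in F) X)%classic k) ->
  s = [::] \/ exists2 X, F X & forall k, k \in s -> X k.
Proof.
move=> Ftot; elim: s => [|k s IH] sF; [by left | right].
have [X FX Xk] := sF k (mem_head k s).
have [|s0|[Y FY Ys]] := IH; first by move=> i si; apply: sF; rewrite inE si orbT.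
  by exists X => // i; rewrite s0 inE => /eqP->.
have [XY|YX] := Ftot X Y FX FY; [exists Y | exists X] => // i.
  by rewrite inE => /orP[/eqP->|/Ys]; [exact: XY |].
by rewrite inE => /orP[/eqP->|/Ys/YX].
Qed.

Lemma residue_basis : exists (K : choiceType) (b : K -> N),
  (forall n, exists u : {freeg K / R}, n - fglift b u \in mN) /\
  (forall u : {freeg K / R}, fglift b u \in mN -> forall k, coeff k u \in m).
Proof.
have [F FP Ftot|A [Afree Amax]] := @Zorn_bigcup N residue_free.
  move=> z zF; have [z0|[X FX]] := chain_seq Ftot zF; last exact: FP.
  by move=> _ k; rewrite coeff_outdom ?z0 // idealr0.
pose K : choiceType := {x : N | `[< A x >]}.
pose b : K -> N := val.
have bA k : A (b k) by exact/asboolP/(valP k).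
exists K, b; split=> [n|u uN k]; last first.
  pose z : {linear {freeg K / R} -> res0 N} := fglift (fun k => fggen R (b k)).
  have zE i : z (fggen R i) = fggen R (b i) by exact: fglift_gen.
  have augz : res_aug N (z u) = fglift b u.
    apply: (freeg_linear_ext (f := res_aug N \o z) (g := fglift b)) => i.
    by apply: etrans (esym (fglift_gen b i)); rewrite /= zE res_aug_gen.
  have cz i : coeff i (z u) = \sum_(j <- dom u) coeff j u * (b j == i)%:R.
    rewrite [in LHS](freeg_gen_sum u) linear_sum raddf_sum /=.
    apply: eq_bigr => j _; rewrite linearZZ.
    by rewrite coeffZ zE coeffU mul1r.
  have -> : coeff k u = coeff (b k) (z u).
    rewrite cz; have [ku|ku] := boolP (k \in dom u).
      rewrite (bigD1_seq k) ?uniq_dom //= eqxx mulr1 big1 ?addr0 // => j jk.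
      by rewrite (inj_eq val_inj) (negPf jk) mulr0.
    rewrite coeff_outdom // big1_seq // => j /= ju.
    have /negPf jk : j != k by apply: contraNneq ku => <-.
    by rewrite (inj_eq val_inj) jk mulr0.
  apply: Afree; last by rewrite augz.
  move=> i; rewrite mem_dom cz; apply: contraPP => nA.
  apply/negP; rewrite negbK big1 // => j _.
  by case: eqP => [ji|_]; [case: nA; rewrite -ji | rewrite mulr0].
suff [z zA zn] : exists2 z : res0 N, (forall k, k \in dom z -> A k)
    & n - res_aug N z \in mN.
  suff [u uE] : exists u : {freeg K / R}, fglift b u = res_aug N z.
    by exists u; rewrite uE.
  have -> : res_aug N z = \sum_(k <- dom z) coeff k z *: k by exact: fglift_sum.
  elim: (dom z) zA => [_|k s IH sA].
    by exists 0; rewrite big_nil linear0.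
  have [|u uE] := IH; first by move=> i si; apply: sA; rewrite inE si orbT.
  have Ak : `[< A k >] by apply/asboolP/sA/mem_head.
  exists (coeff k z *: fggen R (Sub k Ak : K) + u).
  rewrite linearD linearZ /= fglift_gen uE big_cons.
  by rewrite /b SubK.
apply: contrapT => nz.
have nA : ~ A n.
  move=> An; apply: nz; exists (fggen R n); last by rewrite res_aug_gen subrr rpred0.
  by move=> k; rewrite domU1 inE => /eqP->.
(* If [n] were not spanned modulo mN, it could be added to A. In a relation, the coefficient [c] of
   [n] either lies in m, leaving a relation on A, or is invertible modulo m, which expresses [n]
   through A. *)
apply: (Amax (A `|` [set n])%classic).
  by split=> [k Ak|/(_ n)]; [left | move=> h; apply: nA; apply: h; right].
move=> z zB zN; pose c := coeff n z; pose z0 : res0 N := z - c *: fggen R n.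
have augz0 : res_aug N z0 = res_aug N z - c *: n.
  by rewrite linearB linearZZ res_aug_gen.
have z0A k : k \in dom z0 -> A k.
  rewrite mem_dom; apply: contraPP => nk; apply/negP; rewrite negbK.
  rewrite /z0 coeffB coeffZ coeffU mul1r.
  have [<-|/eqP nk'] := eqVneq n k; first by rewrite mulr1 subrr.
  rewrite mulr0 subr0; apply/eqP/coeff_outdom/negP => /zB[] //= kn.
  by apply: nk'.
have [cm|cm] := boolP (c \in m).
  have z0N : res_aug N z0 \in mN.
    by rewrite augz0 submodB // mem_adic_sub // ideal_pow1.
  move=> k; have := Afree _ z0A z0N k.
  rewrite coeffB coeffZ coeffU => h.
  by rewrite -(subrK (c * (1 * (n == k)%:R)) (coeff k z)) rpredD // mulrC idealMr.
have [v vc] := local_unit mmax cm; case: nz; exists (- v *: z0).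
  by move=> k /domZ_subset/z0A.
rewrite linearZZ augz0 scaleNr opprK scalerBr scalerA.
have -> : n + (v *: res_aug N z - (v * c) *: n) = v *: res_aug N z - (v * c - 1) *: n.
  by rewrite scalerBl scale1r opprB addrCA.
by apply: submodB; [exact: rpredZ | rewrite mem_adic_sub ?ideal_pow1].
Qed.

End ResidueBasis.

Section FlatModules.
Variables (R : comNzRingType) (m : idealr R).
Hypothesis mmax : maximal_ideal m.
Implicit Types M N : lmodType R.

Section ResidueLift.
Variables (N : lmodType R) (K : choiceType) (b : K -> N).
Hypothesis Nflat : flat N.
Hypothesis bspan : forall n, exists u : {freeg K / R}, n - fglift b u \in adic_sub m N 1.
Hypothesis bfree : forall u : {freeg K / R},
  fglift b u \in adic_sub m N 1 -> forall k, coeff k u \in m.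

(** A coordinate function on N/mN lifted to values in R; it is linear only modulo m. *)
Lemma residue_coord k0 : exists c : N -> R,
  (forall a x y, c (a *: x + y) - (a * c x + c y) \in m) /\
  forall k, c (b k) - (k == k0)%:R \in m.
Proof.
have /choice[u uP] := bspan.
have uE x v : x - fglift b v \in adic_sub m N 1 -> coeff k0 (u x) - coeff k0 v \in m.
  move=> xv; rewrite -coeffB; apply: bfree; rewrite linearB.
  by rewrite -(subrBB x) submodB.
exists (fun x => coeff k0 (u x)); split=> [a x y|k].
  rewrite -coeffZ -coeffD; apply: uE; rewrite linearP opprD addrACA -scalerBr.
  by rewrite rpredD ?rpredZ.
have := uE (b k) (fggen R k); rewrite fglift_gen subrr rpred0 coeffU mul1r.
exact.
Qed.

Lemma mem_graded j a (r : R) : a \in ideal_pow m j -> r \in m ->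
  r *: mpi (adic_sub m R^o j.+1) a = 0.
Proof.
move=> aj rm; rewrite -linearZZ; apply/mpi_eq0.
suff : r * a \in ideal_pow m j.+1 by rewrite -adic_sub_regular.
by apply: mem_mspan; exists r, a.
Qed.

(* Flatness embeds (m^j/m^(j+1)) (x) N into (R/m^(j+1)) (x) N; the coordinates
   modulo m then recover the class of each coefficient in m^j/m^(j+1). *)
Lemma flat_graded j (u : {freeg K / R}) :
  (forall k, coeff k u \in ideal_pow m j) -> fglift b u \in adic_sub m N j.+1 ->
  forall k, coeff k u \in ideal_pow m j.+1.
Proof.
move=> uj uN k0; pose B : lmodType R := quotmod (adic_sub m R^o j.+1).
pose q : {linear R^o -> B} := mpi (adic_sub m R^o j.+1).
pose P (x : B) := exists2 a, a \in ideal_pow m j & x = q a.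
have P0 : P 0 by exists 0; rewrite ?ideal_pow0 // linear0.
have PD x y : P x -> P y -> P (x + y).
  by move=> [a aj ->] [c cj ->]; exists (a + c); rewrite ?ideal_powD // linearD.
have PZ r x : P x -> P (r *: x).
  by move=> [a aj ->]; exists (r * a); rewrite ?ideal_powZ // -linearZZ.
pose A : lmodType R := submod_type (mksub P0 PD PZ).
pose iota : {linear A -> B} := @submod_val R B (mksub P0 PD PZ).
have qP k : q (coeff k u) \in mksub P0 PD PZ.
  by apply/mksubP; exists (coeff k u).
pose a k : A := SubmodType (qP k).
have sum0 : \sum_(k <- dom u) tens (a k) (b k) = 0 :> tensor A N.
  have TI : injective (mklin (@tensor_map_linear R A B N iota)).
    by apply: Nflat; exact: val_inj.
  apply: TI; rewrite linear0 linear_sum.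
  (* In (R/m^(j+1)) (x) N the sum becomes 1 (x) [fglift b u], which vanishes because [fglift b u]
     lies in m^(j+1) N. *)
  transitivity (tens (q 1) (fglift b u) : tensor B N).
    rewrite fglift_sum tens_sumr.
    apply: eq_bigr => k _; rewrite mklinE tensor_mapE tensZr.
    rewrite -tensZl -linearZZ /=; congr (tens (q _) _).
    by rewrite /GRing.scale /= mulr1.
  apply: (adic_sub_ind (P := fun n => tens (q 1) n = 0 :> tensor B N) _ _ _ uN).
  - exact: tens0r.
  - by move=> x y x0 y0; rewrite tensDr x0 y0 addr0.
  - move=> r x rj; rewrite tensZr -tensZl -linearZZ.
    have -> : q (r *: 1) = 0; last exact: tens0l.
    by apply/mpi_eq0; rewrite [r *: 1]mulr1; move: rj; rewrite -adic_sub_regular.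
have [c [cL cb]] := residue_coord k0.
have cq r s x : x \in mksub P0 PD PZ -> r - s \in m -> r *: x = s *: x.
  move=> /mksubP[y yj ->] rs; apply/eqP; rewrite -subr_eq0 -scalerBl.
  by rewrite mem_graded.
(* The pairing is bilinear although [c] is linear only modulo m, because m kills m^j/m^(j+1). *)
have := @tensor_lift R A N B (fun x n => c n *: iota x) _ _ _ (dom u) a b sum0.
have -> : \sum_(k <- dom u) c (b k) *: iota (a k) = q (coeff k0 u).
  under eq_bigr => k _ do rewrite (cq _ _ _ (qP k) (cb k)).
  have [ku|ku] := boolP (k0 \in dom u).
    rewrite (bigD1_seq k0) ?uniq_dom //= eqxx scale1r big1 ?addr0 // => k /negPf ->.
    by rewrite scale0r.
  rewrite coeff_outdom // linear0 big1_seq // => k /= ku'.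
  have /negPf -> : k != k0 by apply: contraNneq ku => <-.
  by rewrite scale0r.
move=> H; rewrite -adic_sub_regular; apply/mpi_eq0; apply: H.
  by move=> x r y z; rewrite linearP scalerDr !scalerA mulrC.
move=> x r y z; rewrite (cq _ _ _ (submod_valP x) (cL r y z)).
by rewrite scalerDl scalerA.
Qed.

Lemma flat_adic_sub j (u : {freeg K / R}) :
  fglift b u \in adic_sub m N j -> u \in adic_sub m {freeg K / R} j.
Proof.
elim: j => [|j IH] uN; first exact: adic_sub0.
apply/adic_sub_coeff/flat_graded => //.
by apply/adic_sub_coeff/IH/adic_subS.
Qed.

(** Surjectivity is Nakayama. For injectivity, [L0_eps] embeds L_0 of the free module in its
    completion, where [flat_adic_sub] applies at every level. *)
Lemma flat_L0_iso : bijective (L0_map m (fglift b : {linear {freeg K / R} -> N})).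
Proof.
set f : {linear _ -> N} := fglift b.
apply: inj_surj_bij => [|q]; last exact: L0_map_surj.
apply: linear_inj => q /(congr1 (@L0_eps R m N)); rewrite L0_eps_map => fq0.
apply: (L0_eps_inj (freeg_lifting (K := K))); rewrite linear0.
apply: completion_ext => k; rewrite -completion_repK; apply/mpi_eq0/flat_adic_sub.
apply/mpi_eq0; rewrite -completion_mapE fq0.
by rewrite [L0_eps 0]linear0.
Qed.

End ResidueLift.

Lemma flat_pro_free N : flat N -> pro_free m (L0 m N).
Proof.
move=> Nflat; have [K [b [bspan bfree]]] := residue_basis N mmax.
exists {freeg K / R}; first by exists K, idfun; exists idfun.
have [g gK Kg] := bijective_linear_inv (flat_L0_iso Nflat bspan bfree).
by exists g; exists (L0_map m (fglift b : {linear {freeg K / R} -> N})).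
Qed.

End FlatModules.

(** * Equivalence of projectivity, pro-freeness and flatness *)

Theorem propositionA15 (R : comNzRingType) (m : idealr R) :
  regular_local m -> adic_complete m ->
  (forall M : lmodType R, L_complete m M ->
     (Lc_projective m M <-> pro_free m M) /\ (pro_free m M <-> flat M)) /\
  (forall N : lmodType R, flat N -> pro_free m (L0 m N) /\ flat (L0 m N)).
Proof.
move=> [noethR [mmax _] [d [x [_ mE]]]] Rcomplete.
have free_flat (K : choiceType) : equational (completion m {freeg K / R}).
  exact: completed_free_equational.
have pro_free_flat M : pro_free m M -> flat M.
  move=> [F Ffree [phi /bijective_linear_inv[psi phiK _]]].
  have [e epsK _] := bijective_linear_inv (L0_eps_bij m (free_module_lifting Ffree)).
  have [K [g /bijective_linear_inv[h gK _]]] := Ffree.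
  (* A pro-free module is a retract of the completion of [{freeg K / R}], through L_0 F and the
     completion of F. *)
  pose s : {linear M -> completion m {freeg K / R}} :=
    @completion_map R m _ _ g \o @L0_eps R m F \o phi.
  pose t : {linear completion m {freeg K / R} -> M} :=
    psi \o e \o @completion_map R m _ _ h.
  apply: equational_flat; apply: (equational_retract (s := s) (t := t)) (free_flat K).
  by move=> y; rewrite /s /t /= -completion_map_comp completion_map_id ?epsK ?phiK.
have flat_free M : L_complete m M -> flat M -> pro_free m M.
  move=> Mc /(flat_pro_free mmax)[F Ffree [phi phib]].
  by exists F => //; exists (phi \o @L0_eta R m M); exact: bij_comp.
split=> [M Mc|N Nflat]; last first.
  by have Npf := flat_pro_free mmax Nflat; split=> //; exact: pro_free_flat.
split; split=> [Mp|Mpf].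
(* Projective implies pro-free by way of flatness: a retract of a completed free module inherits the
   equational criterion. *)
- have [K [i [r iK]]] := projective_retract mE Mc Mp.
  exact/(flat_free M Mc)/equational_flat/(equational_retract iK)/free_flat.
- exact: pro_free_projective mE _ Mpf.
- exact: pro_free_flat.
- exact: flat_free.
Qed.
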